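(* Let $D$ be the second-order matrix valued differential operator acting from the right on $N\times N$ matrix valued $C^2$-functions $Q$ by $$(QD)(x)=\frac{d^2Q}{dx^2}(x)\,F_2(x)+\frac{dQ}{dx}(x)\,F_1(x)+Q(x)\,F_0(x),$$ with $F_2(x)=I$, $F_1(x)=-2x+2A^\alpha$, $F_0(x)=-2J$. Then $D$ is symmetric with respect to $W^{(\alpha,\nu)}$. Moreover, the monic matrix valued orthogonal polynomials $P_n^{(\alpha,\nu)}$ with respect to $W^{(\alpha,\nu)}$ satisfy $$P_n^{(\alpha,\nu)}D=\Gamma_nP_n^{(\alpha,\nu)},\qquad \Gamma_n=-2n-2J,\qquad n\in\mathbb{N}.$$
   Context: $N\ge1$ is an integer; scalars in matrix expressions denote multiples of the identity, and $^\ast$ is the conjugate transpose. $H_n$ are the Hermite polynomials defined by $\sum_{n\ge0}\frac{t^n}{n!}H_n(x)=e^{2xt-t^2}$. $L(x)$ is the lower triangular $N\times N$ matrix with $L(x)_{m,n}=\frac{H_{m-n}(x)}{(m-n)!}$ for $m\ge n$ and $0$ for $m<n$, $m,n\in\{1,\dots,N\}$. $A=2\sum_{j=2}^N E_{j,j-1}$ with $E_{j,k}$ the matrix units. $\alpha_1,\dots,\alpha_N$ are non-zero real numbers with $\alpha_1=1$, $S^\alpha=\mathrm{diag}(\alpha_1,\dots,\alpha_N)$, $L^\alpha(x)=S^\alpha L(x)(S^\alpha)^{-1}$, $A^\alpha=S^\alpha A(S^\alpha)^{-1}$, $J=\mathrm{diag}(1,2,\dots,N)$. $\Delta^{(\nu)}=\mathrm{diag}(\delta_1^{(\nu)},\dots,\delta_N^{(\nu)})$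 is a diagonal matrix with all $\delta_k^{(\nu)}>0$ ($\nu$ is a label), and the weight on $\mathbb{R}$ is $$W^{(\alpha,\nu)}(x)=e^{-x^2}L^\alpha(x)\,\Delta^{(\nu)}\,L^\alpha(x)^\ast.$$ $P_n^{(\alpha,\nu)}$ is the unique matrix polynomial of degree $n$ with leading coefficient $I$ such that $\int_{\mathbb{R}}P_n^{(\alpha,\nu)}(x)W^{(\alpha,\nu)}(x)P_m^{(\alpha,\nu)}(x)^\ast dx=0$ for $n\ne m$. For a matrix weight $W$ on an interval $(a,b)$ ($a,b$ possibly infinite), $D$ is called symmetric with respect to $W$ if $\int_a^b(GD)(x)W(x)H(x)^\ast dx=\int_a^bG(x)W(x)\bigl((HD)(x)\bigr)^\ast dx$ for all matrix valued $C^2([a,b])$-functions $G,H$; here $a=-\infty$, $b=\infty$.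
   Formalization: Symmetry of D is stated for C^2 functions G, H on the real line such that G, GD, H, HD are square integrable with respect to W; for arbitrary C^2 functions on the line the integrals may not exist or may differ. *)

(* Defs.v *)
From HB Require Import structures.
From mathcomp Require Import all_boot all_order all_algebra.
From mathcomp Require Import spectral complex.
From mathcomp Require Import all_classical all_reals all_analysis.

Set Implicit Arguments.
Unset Strict Implicit.
Unset Printing Implicit Defensive.

Import Order.TTheory GRing.Theory Num.Theory.
Import numFieldNormedType.Exports.

Local Open Scope classical_set_scope.
Local Open Scope ring_scope.
Local Open Scope complex_scope.
Local Open Scope sesquilinear_scope.

Section MatrixFunctions.
Context {R : realType} {m : nat}.
Notation C := R[i].
Notation mu := (@lebesgue_measure R).
Implicit Types F G Q : R -> 'M[C]_m.

(* A matrix-valued function of a real variable is differentiated and integrated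
   through the real and imaginary parts of its entries. *)
Definition mx_re F (i j : 'I_m) : R -> R := fun x => complex.Re (F x i j).
Definition mx_im F (i j : 'I_m) : R -> R := fun x => complex.Im (F x i j).

Definition mx_deriv F : R -> 'M[C]_m :=
  fun x => \matrix_(i, j) (derive1 (mx_re F i j) x +i* derive1 (mx_im F i j) x).

Definition C2fun (f : R -> R) : Prop :=
  [/\ forall x, derivable f x 1,
      forall x, derivable (derive1 f) x 1
    & continuous (derive1n 2 f)].

Definition mx_C2 F : Prop :=
  forall i j, C2fun (mx_re F i j) /\ C2fun (mx_im F i j).

Definition mx_integrable F : Prop :=
  forall i j, mu.-integrable setT (EFin \o mx_re F i j) /\
              mu.-integrable setT (EFin \o mx_im F i j).

Definition mx_integral F : 'M[C]_m :=
  \matrix_(i, j) ((\int[mu]_(x in setT) mx_re F i j x) +i*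
                  (\int[mu]_(x in setT) mx_im F i j x)).

Definition sq_integrable (W : R -> 'M[C]_m) G : Prop :=
  mx_integrable (fun x => G x *m W x *m (G x)^t*).

Definition right_diffop (F2 F1 F0 : R -> 'M[C]_m) Q : R -> 'M[C]_m :=
  fun x => mx_deriv (mx_deriv Q) x *m F2 x + mx_deriv Q x *m F1 x + Q x *m F0 x.

(* For arbitrary C^2 functions on the whole line the two integrals need not
   exist, and they may exist and differ; the test functions are therefore those
   of the maximal L^2(W) domain of D.  It contains all matrix polynomials and all
   C^2 functions with polynomially bounded derivatives up to order 2 when W has
   finite moments and D has polynomial coefficients. *)
Definition symmetric_wrt (W : R -> 'M[C]_m)
    (D : (R -> 'M[C]_m) -> (R -> 'M[C]_m)) : Prop :=
  forall G H : R -> 'M[C]_m,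
    mx_C2 G -> mx_C2 H ->
    sq_integrable W G -> sq_integrable W (D G) ->
    sq_integrable W H -> sq_integrable W (D H) ->
    mx_integral (fun x => D G x *m W x *m (H x)^t*) =
    mx_integral (fun x => G x *m W x *m (D H x)^t*).

End MatrixFunctions.

Definition mx_poly_fun {R : realType} {N : nat} (p : {poly 'M[R[i]]_N.+1}) :
  R -> 'M[R[i]]_N.+1 := fun x => p.[(x%:C)%:M].

Definition is_monic_MVOP {R : realType} {N : nat} (W : R -> 'M[R[i]]_N.+1)
    (P : nat -> {poly 'M[R[i]]_N.+1}) : Prop :=
  [/\ forall n, size (P n) = n.+1,
      forall n, P n \is monic
    & forall n k, n <> k ->
        mx_integral (fun x => mx_poly_fun (P n) x *m W x
                              *m (mx_poly_fun (P k) x)^t*) = 0].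

Definition is_hermite {R : realType} (H : nat -> {poly R}) : Prop :=
  forall x t : R,
    series (fun n => t ^+ n / n`!%:R * (H n).[x]) @ \oo
      --> expR (2 * x * t - t ^+ 2).

(* Matrices have size N.+1 and are indexed from 0: the entry (i, j) below is the
   usual entry (i+1, j+1). *)
Section Weight.
Context {R : realType} {N : nat}.
Notation C := R[i].
Implicit Types (H : nat -> {poly R}) (alpha delta : 'I_N.+1 -> R) (x : R).

Definition real_diag (d : 'I_N.+1 -> R) : 'M[C]_N.+1 :=
  diag_mx (\row_i (d i)%:C).

Definition Lmx H x : 'M[C]_N.+1 :=
  \matrix_(i, j) if (j <= i)%N then ((H (i - j)%N).[x] / (i - j)`!%:R)%:C else 0.

Definition Amx : 'M[C]_N.+1 :=
  2 *: \sum_(j < N) delta_mx (lift ord0 j) (widen_ord (leqnSn N) j).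

Definition Jmx : 'M[C]_N.+1 := real_diag (fun i => i.+1%:R).

Definition Lalpha H alpha x : 'M[C]_N.+1 :=
  real_diag alpha *m Lmx H x *m invmx (real_diag alpha).

Definition Aalpha alpha : 'M[C]_N.+1 :=
  real_diag alpha *m Amx *m invmx (real_diag alpha).

Definition Walpha H alpha delta x : 'M[C]_N.+1 :=
  (expR (- x ^+ 2))%:C *:
    (Lalpha H alpha x *m real_diag delta *m (Lalpha H alpha x)^t*).

Definition D_hermite alpha : (R -> 'M[C]_N.+1) -> (R -> 'M[C]_N.+1) :=
  right_diffop (fun=> 1%:M)
               (fun x => - (2 * x%:C)%:M + 2 *: Aalpha alpha)
               (fun=> - (2 *: Jmx)).

Definition Gamma (n : nat) : 'M[C]_N.+1 := - (2 * n%:R)%:M - 2 *: Jmx.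

End Weight.

(* Main.v *)
Require Import Defs.
From HB Require Import structures.
From mathcomp Require Import all_boot all_order all_algebra.
From mathcomp Require Import complex.
From mathcomp Require Import all_classical all_reals all_analysis.
From mathcomp Require Import measurable_realfun spectral zify ring lra.

(** The factor L(x) of the weight is exp(xA - A^2/4), conjugated by the diagonal
    matrix of the alpha_k. It satisfies L' = A L, and the three-term recurrence of
    the Hermite polynomials says J L = L J + x A L - A^2 L / 2. Together they show
    that, for U = Q L, the operator D becomes

      (Q D) L = U'' - 2x U' - 2 U J,

    in which the entries of U are decoupled: the j-th column sees the scalar
    Hermite operator u'' - 2xu' - 2ju (D_hermite_twist). As the weight is
    e^{-x^2} L Delta L^*, the pairing of two matrix functions is a positive
    combination of scalar pairings with weight e^{-x^2} (W_entry). Symmetry of D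
    is thereby reduced to symmetry of the scalar operator on its maximal
    square-integrable domain (hermite_op_symmetric).

    That is a limit-point statement, and nothing is known about u' and v' at
    infinity. It is proved by a cut-off: with phi = 1 - (x/n)^2, the function

      phi^2 e^{-x^2} ((u'v - uv') + (4/n) (uu' + vv'))

    vanishes at -n and n, so its derivative has integral 0 on [-n, n]. The energy
    flux uu' + vv' contributes u'^2 + v'^2, which absorbs the errors coming from
    phi', and what remains bounds the integral of phi^2 e^{-x^2} (lu v - u lv) by
    a constant over n (cutoff_defect_le). Letting n grow gives one inequality, and
    exchanging u and v gives the other.

    The recurrence and the derivative formula of the Hermite polynomials are
    extracted from the generating function F(t) = e^{2xt - t^2} by term-by-term
    differentiation, F' = (2x - 2t) F, and uniqueness of power series
    coefficients.

    For the orthogonal polynomials, D does not raise degrees, and the coefficient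
    of degree n of P_n D is -2n - 2J = Gamma_n. So r = P_n D - Gamma_n P_n has
    degree less than n, and symmetry gives
    <r, r> = <P_n, r D> - Gamma_n <P_n, r> = 0. The pairing is definite on
    polynomials because all delta_k are positive and L is invertible, hence
    r = 0 (MVOP_eigen). *)

Set Implicit Arguments.
Unset Strict Implicit.
Unset Printing Implicit Defensive.

Import Order.TTheory GRing.Theory Num.Theory.
Import numFieldNormedType.Exports.

Local Open Scope classical_set_scope.
Local Open Scope ring_scope.
Local Open Scope complex_scope.
Local Open Scope sesquilinear_scope.

(** * Continuity and derivatives of explicit real functions *)

Section Basics.
Context {R : realType}.
Implicit Types (u v f g : R -> R) (x c b a : R).

Lemma is_derive_gauss x : is_derive x 1 gauss_fun (- (2 * x) * gauss_fun x).
Proof.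
rewrite /gauss_fun.
have h : is_derive x 1 (fun y : R => - y ^+ 2) (- (2 * x)).
  apply: is_derive_eq.
  by rewrite /GRing.scale /=; ring.
have := @is_derive1_comp _ expR (fun y : R => - y ^+ 2) x _ _ (is_derive_expR _) h.
by move=> /is_derive_eq; apply; ring.
Qed.

Lemma continuous_is_derive f (df : R -> R) :
  (forall x, is_derive x 1 f (df x)) -> continuous f.
Proof.
move=> h x; apply: differentiable_continuous; apply/derivable1_diffP.
by have [] := h x.
Qed.

Lemma continuousDf f g : continuous f -> continuous g -> continuous (fun x => f x + g x).
Proof. by move=> cf cg x; apply: continuousD; [exact: cf|exact: cg]. Qed.
Lemma continuousNf f : continuous f -> continuous (fun x => - f x).
Proof. by move=> cf x; apply: continuousN; exact: cf. Qed.
Lemma continuousMf f g : continuous f -> continuous g -> continuous (fun x => f x * g x).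
Proof. by move=> cf cg x; apply: continuousM; [exact: cf|exact: cg]. Qed.
Lemma continuousXf f k : continuous f -> continuous (fun x => f x ^+ k).
Proof.
move=> cf x; apply: (@continuous_comp _ _ _ f (fun y => y ^+ k)); first exact: cf.
exact: exprn_continuous.
Qed.
Lemma continuous_cstf c : continuous (fun _ : R => c).
Proof. by move=> x; exact: cvg_cst. Qed.
Lemma continuous_idf : continuous (fun x : R => x).
Proof. by move=> x; exact: cvg_id. Qed.

Lemma is_derive_cstf c x : is_derive x 1 (fun _ : R => c) 0.
Proof. exact: is_derive_cst. Qed.
Lemma is_derive_idf x : is_derive x 1 (fun y : R => y) 1.
Proof. exact: is_derive_id. Qed.

Lemma is_deriveMf f g x df dg : is_derive x 1 f df -> is_derive x 1 g dg ->
  is_derive x 1 (fun y => f y * g y) (df * g x + f x * dg).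
Proof.
move=> hf hg; apply: is_derive_eq; rewrite -[LHS]/(f x * dg + g x * df); ring.
Qed.
Lemma is_deriveDf f g x df dg : is_derive x 1 f df -> is_derive x 1 g dg ->
  is_derive x 1 (fun y => f y + g y) (df + dg).
Proof. by move=> hf hg; exact: is_deriveD. Qed.
Lemma is_deriveNf f x df : is_derive x 1 f df ->
  is_derive x 1 (fun y => - f y) (- df).
Proof. by move=> hf; exact: is_deriveN. Qed.

End Basics.

(** Directed by the head symbol of the expression, so that unification never
    unfolds the functions it is built from. *)
Ltac continuity := lazymatch goal with |- forall x, continuous_at x ?F =>
  lazymatch F with
  | (fun _ => ?c) => exact: (@continuous_cstf _ c)
  | (fun y => y) => exact: continuous_idf
  | (fun y => (@?f y + @?g y)%R) => apply: (@continuousDf _ f g); continuity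
  | (fun y => (- (@?f y))%R) => apply: (@continuousNf _ f); continuity
  | (fun y => (@?f y * @?g y)%R) => apply: (@continuousMf _ f g); continuity
  | (fun y => (@?f y ^+ ?k)%R) => apply: (@continuousXf _ f k); continuity
  | _ => first [assumption | exact: continuous_gauss_fun]
  end end.

Section CutoffFlux.
Context {R : realType}.
Implicit Types (u v f g : R -> R) (x c b a : R).

(** u1 and u2 stand for the first two derivatives of u. Passing them separately
    avoids derivability side conditions when the operator is rewritten. *)
Definition hermite_op c u (u1 u2 : R -> R) x := u2 x - 2 * x * u1 x - c * u x.

(** The pointwise inequality behind the cut-off argument, with p the cut-off, d
    its derivative and a = 4/n. Young's inequality bounds the terms containing d
    by multiples of p^2 u1^2 and p^2 v1^2; these are exactly compensated by the
    terms a p^2 u1^2 and a p^2 v1^2, so that no bound on the derivatives u1, v1 is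
    needed and only zeroth-order quantities remain. The constant c enters through
    a c p^2 (u^2 + v^2), which has the right sign as c >= 0. *)
Lemma cutoff_flux_bound (a p d c u u1 v v1 lu lv : R) :
  0 < a <= 4 -> 0 <= p <= 1 -> `|d| <= a / 2 -> 0 <= c ->
  p ^+ 2 * (lu * v - u * lv) - 10 * a * (u ^+ 2 + lu ^+ 2 + v ^+ 2 + lv ^+ 2) <=
  p ^+ 2 * ((lu + c * u) * v - u * (lv + c * v)
            + a * (u1 ^+ 2 + u * (lu + c * u) + v1 ^+ 2 + v * (lv + c * v)))
  + 2 * p * d * ((u1 * v - u * v1) + a * (u * u1 + v * v1)).
Proof.
move=> /andP[a0 a4] /andP[p0 p1]; rewrite ler_norml => /andP[d1 d2] c0.
(* From |d| <= a/2: the difference is a nonnegative combination of (s + t)^2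
   and (s - t)^2. *)
have key (s t : R) : - (a / 2) * (s ^+ 2 + t ^+ 2) <= 2 * d * s * t.
  have h1 : 0 <= (a / 2 + d) * (s + t) ^+ 2 by rewrite mulr_ge0 ?sqr_ge0//; lra.
  have h2 : 0 <= (a / 2 - d) * (s - t) ^+ 2 by rewrite mulr_ge0 ?sqr_ge0//; lra.
  by rewrite -subr_ge0; rewrite [leRHS](_ : _ =
    ((a / 2 + d) * (s + t) ^+ 2 + (a / 2 - d) * (s - t) ^+ 2) / 2); [lra|field].
have k1 := key (p * u1) v.
have k2 := key (p * v1) (- u).
have k3 := key (p * u1) (a * u).
have k4 := key (p * v1) (a * v).
have pp : p ^+ 2 <= 1 by rewrite expr_le1.
have young (s t : R) : - a * (s ^+ 2 + t ^+ 2) / 2 <= a * p ^+ 2 * (s * t).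
  have h1 : 0 <= a * p ^+ 2 * (s + t) ^+ 2.
    exact: mulr_ge0 (mulr_ge0 (ltW a0) (sqr_ge0 _)) (sqr_ge0 _).
  have h2 : 0 <= a * (1 - p ^+ 2) * (s ^+ 2 + t ^+ 2).
    by apply: mulr_ge0; [apply: mulr_ge0; lra|rewrite addr_ge0 ?sqr_ge0].
  by rewrite -subr_ge0 [leRHS](_ : _ = (a * p ^+ 2 * (s + t) ^+ 2
     + a * (1 - p ^+ 2) * (s ^+ 2 + t ^+ 2)) / 2); [lra|field].
have y1 := young u lu.
have y2 := young v lv.
have cu : 0 <= a * c * p ^+ 2 * (u ^+ 2 + v ^+ 2).
  apply: mulr_ge0; last by rewrite addr_ge0 ?sqr_ge0.
  exact: mulr_ge0 (mulr_ge0 (ltW a0) c0) (sqr_ge0 _).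
(* This is where a <= 4, that is n >= 1, is used. *)
have aa (s : R) : a ^+ 3 * s ^+ 2 <= 16 * a * s ^+ 2.
  have h : 0 <= a * ((4 - a) * (4 + a)) by do 2?apply: mulr_ge0; lra.
  rewrite ler_wpM2r ?sqr_ge0//; lra.
have a1 := aa u; have a2 := aa v.
have q1 : 0 <= a * u ^+ 2 by rewrite mulr_ge0 ?sqr_ge0 ?ltW.
have q2 : 0 <= a * v ^+ 2 by rewrite mulr_ge0 ?sqr_ge0 ?ltW.
have q3 : 0 <= a * lu ^+ 2 by rewrite mulr_ge0 ?sqr_ge0 ?ltW.
have q4 : 0 <= a * lv ^+ 2 by rewrite mulr_ge0 ?sqr_ge0 ?ltW.
lra.
Qed.

(** The Wronskian flux of Green's formula, times the squared cut-off
    (1 - b x^2)^2, plus a small multiple a of the energy flux u u' + v v'. The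
    derivative of the energy flux produces the positive terms u'^2 + v'^2 that
    absorb the error created by differentiating the cut-off. *)
Definition cutoff_flux a b u (u1 : R -> R) v (v1 : R -> R) x : R :=
  gauss_fun x * ((1 - b * x ^+ 2) ^+ 2 *
    ((u1 x * v x - u x * v1 x) + a * (u x * u1 x + v x * v1 x))).

Definition cutoff_flux_deriv a b c u (u1 u2 : R -> R) v (v1 v2 : R -> R) x : R :=
  let p := 1 - b * x ^+ 2 in
  let lu := hermite_op c u u1 u2 x in let lv := hermite_op c v v1 v2 x in
  gauss_fun x * (p ^+ 2 * ((lu + c * u x) * v x - u x * (lv + c * v x)
            + a * (u1 x ^+ 2 + u x * (lu + c * u x)
                   + v1 x ^+ 2 + v x * (lv + c * v x)))
  + 2 * p * (- (2 * b * x)) * ((u1 x * v x - u x * v1 x)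
       + a * (u x * u1 x + v x * v1 x))).

(** Here (e^{-x^2} u1)' = e^{-x^2} (lu + c u), because e^{-x^2} turns the
    operator into divergence form. *)
Lemma is_derive_cutoff_flux a b c u (u1 u2 : R -> R) v (v1 v2 : R -> R) :
  (forall x, is_derive x 1 u (u1 x)) -> (forall x, is_derive x 1 u1 (u2 x)) ->
  (forall x, is_derive x 1 v (v1 x)) -> (forall x, is_derive x 1 v1 (v2 x)) ->
  forall x, is_derive x 1 (cutoff_flux a b u u1 v v1) (cutoff_flux_deriv a b c u u1 u2 v v1 v2 x).
Proof.
move=> hu hu1 hv hv1 x; pose p := fun x => 1 - b * x ^+ 2.
have hp : is_derive x 1 p (- (2 * b * x)).
  rewrite /p; apply: is_derive_eq.
  rewrite /GRing.scale /=; ring.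
have hp2 : is_derive x 1 (fun x => p x ^+ 2) (2 * p x * (- (2 * b * x))).
  rewrite (_ : (fun x => p x ^+ 2) = fun x => p x * p x); last by apply/funext => y; rewrite expr2.
  have := is_deriveMf hp hp; move=> /is_derive_eq; apply.
  ring.
have hw := is_deriveDf (is_deriveMf (hu1 x) (hv x)) (is_deriveNf (is_deriveMf (hu x) (hv1 x))).
have hq := is_deriveDf (is_deriveMf (hu x) (hu1 x)) (is_deriveMf (hv x) (hv1 x)).
have := is_deriveMf (is_derive_gauss x) (is_deriveMf hp2
  (is_deriveDf hw (is_deriveMf (is_derive_cstf a x) hq))).
move=> /is_derive_eq; apply.
rewrite /cutoff_flux_deriv /hermite_op /p /=; ring.
Qed.

End CutoffFlux.

(** * Square integrability against the Gaussian, and the cut-off estimate *)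

Section GaussL2.
Context {R : realType}.
Notation mu := (@lebesgue_measure R).
Implicit Types (u v f g : R -> R) (x c n a : R).
Notation gauss := (@gauss_fun R).

Definition integrableR f := mu.-integrable setT (EFin \o f).

Definition gaussL2 f := continuous f /\ integrableR (fun x => gauss x * f x ^+ 2).

Lemma integrableR_le f g : continuous f -> (forall x, `|f x| <= g x) -> integrableR g -> integrableR f.
Proof.
move=> cf fg; apply: le_integrable => //=.
  by apply/measurable_EFinP; exact: continuous_measurable_fun.
by move=> x _; rewrite lee_fin (le_trans (fg x))// ler_norm.
Qed.

Lemma integrableRD f g : integrableR f -> integrableR g -> integrableR (fun x => f x + g x).
Proof. by move=> hf hg; exact: (integrableD measurableT hf hg). Qed.

Lemma integrableRZ c f : integrableR f -> integrableR (fun x => c * f x).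
Proof. by move=> hf; exact: (integrableZl measurableT c hf). Qed.

(** |f g| is at most f^2 + g^2. *)
Lemma gaussL2_mul f g : gaussL2 f -> gaussL2 g -> integrableR (fun x => gauss x * (f x * g x)).
Proof.
move=> [cf If] [cg Ig].
apply: (@integrableR_le _ (fun x => gauss x * f x ^+ 2 + gauss x * g x ^+ 2)).
- by continuity.
- move=> x; rewrite normrM (ger0_norm (gauss_fun_ge0 _)) -mulrDr ler_wpM2l ?gauss_fun_ge0//.
  have h1 := sqr_ge0 (f x + g x); have h2 := sqr_ge0 (f x - g x).
  have h3 := sqr_ge0 (f x); have h4 := sqr_ge0 (g x).
  by rewrite ler_norml; apply/andP; split; lra.
- exact: integrableRD.
Qed.

Lemma continuous_segment_integrable f n : continuous f ->
  mu.-integrable `[- n, n] (EFin \o f).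
Proof.
move=> cf; apply: continuous_compact_integrable; first exact: segment_compact.
exact: continuous_subspaceT.
Qed.

(** The flux vanishes at both ends of [-n, n], so its derivative integrates to 0
    there; the pointwise bound then controls the integral of the Wronskian
    defect by 1/n times an integral free of derivatives. *)
Lemma cutoff_defect_le c u (u1 u2 : R -> R) v (v1 v2 : R -> R) n : 0 <= c -> 1 <= n ->
  (forall x, is_derive x 1 u (u1 x)) -> (forall x, is_derive x 1 u1 (u2 x)) ->
  (forall x, is_derive x 1 v (v1 x)) -> (forall x, is_derive x 1 v1 (v2 x)) ->
  continuous u2 -> continuous v2 ->
  let lu := hermite_op c u u1 u2 in let lv := hermite_op c v v1 v2 in
  is_true (\int[mu]_(x in `[- n, n])
     (gauss x * ((1 - (x / n) ^+ 2) ^+ 2 * (lu x * v x - u x * lv x))) <=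
  40 / n * \int[mu]_(x in `[- n, n])
     (gauss x * (u x ^+ 2 + lu x ^+ 2 + v x ^+ 2 + lv x ^+ 2))).
Proof.
move=> c0 n1 hu hu1 hv hv1 cu2 cv2 lu lv.
have n0 : 0 < n by lra.
have cu := continuous_is_derive hu; have cu1 := continuous_is_derive hu1.
have cv := continuous_is_derive hv; have cv1 := continuous_is_derive hv1.
have clu : continuous lu by rewrite /lu /hermite_op; continuity.
have clv : continuous lv by rewrite /lv /hermite_op; continuity.
(* a = 4/n is twice the bound 2/n on the derivative of the cut-off. *)
have dE := is_derive_cutoff_flux (4 / n) (n ^- 2) c hu hu1 hv hv1.
set E := cutoff_flux _ _ _ _ _ _ in dE.
pose dE' := cutoff_flux_deriv (4 / n) (n ^- 2) c u u1 u2 v v1 v2.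
have cE : continuous E by exact: continuous_is_derive dE.
have cdE : continuous dE' by rewrite /dE' /cutoff_flux_deriv -/lu -/lv; continuity.
have E0 : \int[mu]_(x in `[- n, n]) dE' x = 0.
  rewrite /Rintegral (@continuous_FTC2 _ dE' E).
  - rewrite /E /cutoff_flux sqrrN mulVf ?subrr ?expr0n ?mul0r ?mulr0 ?subee//.
    by rewrite gt_eqF// exprn_gt0.
  - lra.
  - exact: continuous_subspaceT.
  - split; last 2 first.
    + by apply: cvg_at_right_filter; exact: cE.
    + by apply: cvg_at_left_filter; exact: cE.
    by move=> x _; have [] := dE x.
  - by move=> x _; rewrite derive1E; have [] := dE x.
rewrite -subr_le0 -E0 -RintegralZl//; last first.
  by apply: continuous_segment_integrable; continuity.
rewrite -RintegralB//; try by apply: continuous_segment_integrable; continuity.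
apply: le_Rintegral => //; try by apply: continuous_segment_integrable; continuity.
move=> x /=; rewrite in_itv/= => /andP[x1 x2].
rewrite /dE' /cutoff_flux_deriv -/(lu x) -/(lv x).
have -> : (x / n) ^+ 2 = n ^- 2 * x ^+ 2 by rewrite expr_div_n mulrC.
rewrite [40 / n * _]mulrCA -mulrBr ler_wpM2l ?gauss_fun_ge0//.
have -> : 40 / n = 10 * (4 / n) by rewrite mulrA; congr (_ / _); ring.
apply: cutoff_flux_bound => //.
- by rewrite divr_gt0//= ler_pdivrMr//; lra.
- have : 0 <= n ^- 2 * x ^+ 2 by rewrite mulr_ge0 ?sqr_ge0// invr_ge0 sqr_ge0.
  suff : n ^- 2 * x ^+ 2 <= 1 by lra.
  rewrite mulrC ler_pdivrMr ?exprn_gt0// mul1r -ler_sqrt ?sqr_ge0//.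
  by rewrite !sqrtr_sqr (gtr0_norm n0) ler_norml x1.
- rewrite normrN (_ : 2 * _ * x = (2 / n) * (x / n)); last first.
    by field; rewrite gt_eqF.
  rewrite normrM (@ger0_norm _ (2 / n)); last by rewrite divr_ge0// ltW.
  have -> : 4 / n / 2 = 2 / n * 1 by field; rewrite gt_eqF.
  rewrite ler_wpM2l//; first by rewrite divr_ge0// ltW.
  by rewrite normrM normfV (gtr0_norm n0) ler_pdivrMr// mul1r ler_norml x1.
Qed.

End GaussL2.

(** * Symmetry of the scalar Hermite operator on its maximal domain *)

Section ScalarSymmetry.
Context {R : realType}.
Notation mu := (@lebesgue_measure R).
Implicit Types (u v f g : R -> R) (x c n a : R).
Notation gauss := (@gauss_fun R).

(** Dominated convergence: the cut-offs lie in [0, 1] and tend to 1. *)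
Lemma cutoff_cvg f : continuous f -> integrableR f ->
  (fun k => \int[mu]_(x in `[- k.+1%:R, k.+1%:R])
     ((1 - (x / k.+1%:R) ^+ 2) ^+ 2 * f x)) @ \oo --> \int[mu]_x f x.
Proof.
move=> cf If.
pose D k : set R := [set` `[- k.+1%:R, k.+1%:R]%R].
pose h k x := (1 - (x / k.+1%:R) ^+ 2) ^+ 2 * f x.
have ch k : continuous (h k) by rewrite /h; continuity.
have mh k : measurable_fun setT (h k \_ (D k)).
  apply/(measurable_restrictT _ _).1; first exact: measurable_itv.
  by apply: measurable_funTS; exact: continuous_measurable_fun.
have hle k x : `|(h k \_ (D k)) x| <= `|f x|.
  rewrite patchE; case: ifPn => [|_]; last by rewrite normr0.
  rewrite inE /D /= in_itv/= => /andP[x1 x2].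
  rewrite /h normrM ger0_norm ?sqr_ge0// ler_piMl// expr_le1//.
    by rewrite lerBlDr lerDl sqr_ge0.
  rewrite subr_ge0 -real_normK ?num_real// expr_le1// normrM normfV normr_nat.
  by rewrite ler_pdivrMr// mul1r ler_norml x1.
have hcvg x : (fun k => (h k \_ (D k)) x) @ \oo --> f x.
  have h1 : (fun k => h k x) @ \oo --> f x.
    have h0 : (fun k => x / k.+1%:R : R) @ \oo --> x * 0.
      by apply: cvgMr; exact: cvg_harmonic.
    have cp : continuous (fun y : R => (1 - y ^+ 2) ^+ 2 * f x) by continuity.
    have := cvg_comp _ _ h0 (cp _); rewrite (_ : _ * f x = f x); last by ring.
    exact.
  apply: cvg_trans h1; apply: near_eq_cvg; near=> k.
  rewrite patchE mem_set// /D /= in_itv/= -ler_norml.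
  rewrite (@le_trans _ _ k%:R)//; last by rewrite ler_nat.
  by near: k; exact: nbhs_infty_ger.
have [_ _ H] : [/\ mu.-integrable setT (EFin \o f),
    [sequence \int[mu]_x `|((h k \_ (D k)) x)%:E - (f x)%:E|]_k%E @ \oo --> 0%E &
    [sequence \int[mu]_x ((h k \_ (D k)) x)%:E]_k%E @ \oo --> (\int[mu]_x (f x)%:E)%E].
  apply: (@dominated_convergence _ _ _ mu setT measurableT
    (fun k => EFin \o (h k \_ (D k))) (EFin \o f) (fun x => `|f x|%:E)).
  - by move=> k; apply/measurable_EFinP; exact: mh.
  - by apply/measurable_EFinP; exact: continuous_measurable_fun.
  - apply: aeW => x _; apply: cvg_EFin; first exact: nearW.
    exact: hcvg.
  - exact: integrable_norm.
  - by apply: aeW => x k _; rewrite lee_fin hle.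
have If0 : mu.-integrable setT (EFin \o f) by [].
rewrite [X in X @ _ --> _](_ : _ = fun k => fine (\int[mu]_x ((h k \_ (D k)) x)%:E)%E).
  apply: fine_cvg; rewrite fineK; first exact: H.
  exact: integrable_fin_num.
by apply/funext => k; rewrite Rintegral_mkcond.
Unshelve. all: by end_near. Qed.

Section Green.
Variables (c : R) (c0 : 0 <= c).
(** One inequality is enough, since exchanging u and v reverses it. *)
Lemma hermite_op_symmetric_le u (u1 u2 : R -> R) v (v1 v2 : R -> R) :
  (forall x, is_derive x 1 u (u1 x)) -> (forall x, is_derive x 1 u1 (u2 x)) ->
  (forall x, is_derive x 1 v (v1 x)) -> (forall x, is_derive x 1 v1 (v2 x)) ->
  continuous u2 -> continuous v2 ->
  gaussL2 u -> gaussL2 (hermite_op c u u1 u2) -> gaussL2 v -> gaussL2 (hermite_op c v v1 v2) ->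
  \int[mu]_x (gauss x * (hermite_op c u u1 u2 x * v x)) <=
  \int[mu]_x (gauss x * (u x * hermite_op c v v1 v2 x)).
Proof.
move=> hu hu1 hv hv1 cu2 cv2 Lu LLu Lv LLv.
set lu := hermite_op c u u1 u2 in LLu *; set lv := hermite_op c v v1 v2 in LLv *.
have I1 := gaussL2_mul LLu Lv; have I2 := gaussL2_mul Lu LLv.
rewrite -subr_le0 -RintegralB//.
pose f x := gauss x * (lu x * v x - u x * lv x).
pose q x := gauss x * (u x ^+ 2 + lu x ^+ 2 + v x ^+ 2 + lv x ^+ 2).
have [cu Iu] := Lu; have [cv Iv] := Lv.
have [clu Ilu] := LLu; have [clv Ilv] := LLv.
have cf : continuous f by rewrite /f; continuity.
have If : integrableR f.
  have := integrableRD I1 (integrableRZ (-1) I2).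
  by congr (integrableR _); apply/funext => x; rewrite /f; ring.
have Iq : integrableR q.
  have := integrableRD (integrableRD (integrableRD Iu Ilu) Iv) Ilv.
  by congr (integrableR _); apply/funext => x; rewrite /q; ring.
have -> : \int[mu]_x (gauss x * (lu x * v x) - gauss x * (u x * lv x)) =
          \int[mu]_x f x by apply: eq_Rintegral => x _; rewrite /f; ring.
set K := \int[mu]_x q x.
have qge0 x : 0 <= q x by rewrite mulr_ge0 ?gauss_fun_ge0// !addr_ge0 ?sqr_ge0.
have le_k k : \int[mu]_(x in `[- k.+1%:R, k.+1%:R])
     ((1 - (x / k.+1%:R) ^+ 2) ^+ 2 * f x) <= 40 * K * k.+1%:R^-1.
  have n1 : 1 <= k.+1%:R :> R by rewrite ler1n.
  have := cutoff_defect_le c0 n1 hu hu1 hv hv1 cu2 cv2.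
  rewrite -/lu -/lv => h.
  rewrite [leLHS](_ : _ = \int[mu]_(x in `[- k.+1%:R, k.+1%:R])
     (gauss x * ((1 - (x / k.+1%:R) ^+ 2) ^+ 2 * (lu x * v x - u x * lv x)))); last first.
    by apply: eq_Rintegral => x _; rewrite /f; ring.
  apply: le_trans h _; rewrite [leRHS]mulrAC ler_wpM2l ?divr_ge0//.
  rewrite Rintegral_mkcond; apply: le_Rintegral => //.
    rewrite -restrict_EFin; apply/(integrable_mkcond _ _).1; first exact: measurable_itv.
    by apply: integrableS Iq => //; exact: measurable_itv.
  by move=> x _; rewrite patchE; case: ifP.
apply: (ler_cvg_to (cutoff_cvg cf If) _ (nearW _ le_k)).
by rewrite -[X in _ --> X](mulr0 (40 * K)); apply: cvgMr; exact: cvg_harmonic.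
Qed.

(** Both ends of the line are in the limit-point case: no boundary term
    survives, although nothing is assumed on u' and v' at infinity. *)
Lemma hermite_op_symmetric u (u1 u2 : R -> R) v (v1 v2 : R -> R) :
  (forall x, is_derive x 1 u (u1 x)) -> (forall x, is_derive x 1 u1 (u2 x)) ->
  (forall x, is_derive x 1 v (v1 x)) -> (forall x, is_derive x 1 v1 (v2 x)) ->
  continuous u2 -> continuous v2 ->
  gaussL2 u -> gaussL2 (hermite_op c u u1 u2) -> gaussL2 v -> gaussL2 (hermite_op c v v1 v2) ->
  \int[mu]_x (gauss x * (hermite_op c u u1 u2 x * v x)) =
  \int[mu]_x (gauss x * (u x * hermite_op c v v1 v2 x)).
Proof.
move=> hu hu1 hv hv1 cu2 cv2 Lu LLu Lv LLv.
apply/eqP; rewrite eq_le (hermite_op_symmetric_le hu hu1 hv hv1)//=.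
have := hermite_op_symmetric_le hv hv1 hu hu1 cv2 cu2 Lv LLv Lu LLu.
by congr (_ <= _); apply: eq_Rintegral => x _; congr (_ * _); rewrite mulrC.
Qed.
End Green.
End ScalarSymmetry.

(** * Hermite polynomials from their generating function *)

Section Hermite.
Context {R : realType}.
Implicit Types (a b : nat -> R) (x t : R).

Definition pseries_sum a (F : R -> R) := forall t, pseries a t @ \oo --> F t.

(** An everywhere convergent power series converges absolutely everywhere, and
    n + 1 <= 2^n, so the derived series at t is dominated by the original one at
    2|t| + 1. *)
Lemma pseries_sum_diffs a F : pseries_sum a F ->
  pseries_sum (pseries_diffs a) (fun t => limn (pseries (pseries_diffs a) t)).
Proof.
move=> h t; suff: cvgn (pseries (pseries_diffs a) t) by [].
(* The extra 1 leaves room for the additional factor z in z^(n+1). *)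
pose z := 2 * `|t| + 1.
have z0 : 0 <= z by rewrite addr_ge0// mulr_ge0.
have hz : cvgn (pseries (fun i => `|a i|) z).
  apply: (@is_cvg_pseries_inside_norm _ _ (z + 1)).
    by apply/cvg_ex; exists (F (z + 1)); exact: h.
  by rewrite !ger0_norm ?addr_ge0// ltrDl.
have hz1 : cvgn (series (fun n => `|a n.+1| * z ^+ n.+1)).
  have -> : series (fun n => `|a n.+1| * z ^+ n.+1) =
      (fun n => pseries (fun i => `|a i|) z n.+1 - `|a 0|).
    apply/funext => n; rewrite /pseries /series/= big_nat_recl//= expr0 mulr1.
    by rewrite addrAC subrr add0r.
  apply: is_cvgB; last exact: is_cvg_cst.
  move/cvg_ex: hz => [l hl]; apply/cvg_ex; exists l.
  by rewrite (cvg_shiftS (pseries (fun i => `|a i|) z)).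
apply: normed_cvg; apply: series_le_cvg hz1 => /=.
- by move=> n; exact: normr_ge0.
- by move=> n; rewrite mulr_ge0// exprn_ge0.
move=> n; rewrite /pseries_diffs !normrM normrX normr_nat mulrAC mulrC.
rewrite ler_wpM2l//.
have n2 : n.+1%:R <= 2 ^+ n :> R by rewrite -natrX ler_nat ltn_expl.
apply: (@le_trans _ _ ((2 * `|t|) ^+ n)).
  by rewrite exprMn ler_wpM2r// exprn_ge0.
apply: (@le_trans _ _ (z ^+ n)).
  by rewrite lerXn2r ?nnegrE ?mulr_ge0// lerDl.
by rewrite exprSr ler_peMr ?exprn_ge0// lerDr mulr_ge0.
Qed.

Lemma is_derive_pseries_sum a F t : pseries_sum a F ->
  is_derive t 1 F (limn (pseries (pseries_diffs a) t)).
Proof.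
move=> h; have h1 := pseries_sum_diffs h; have h2 := pseries_sum_diffs h1.
have -> : F = fun t => limn (pseries a t).
  by apply/funext => y; apply/esym/cvg_lim => //; exact: h.
apply: (@pseries_snd_diffs _ _ (`|t| + 1)).
- by apply/cvg_ex; exists (F (`|t| + 1)); exact: h.
- by apply/cvg_ex; eexists; exact: h1.
- by apply/cvg_ex; eexists; exact: h2.
- by rewrite [ltRHS]ger0_norm ?addr_ge0// ltrDl.
Qed.

(** Uniqueness of power series coefficients, by differentiating the zero
    function term by term. *)
Lemma pseries_sum0 a : pseries_sum a (fun=> 0) -> forall k, a k = 0.
Proof.
move=> h k; elim: k a h => [a h|k ih a h].
  have := h 0; move/cvg_lim => /(_ (@norm_hausdorff _ _)) <-.
  apply/esym/lim_near_cst; first exact: norm_hausdorff.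
  near=> n; rewrite /pseries/= /series/=.
  rewrite -[n]prednK; last by near: n; exists 1%N.
  rewrite big_nat_recl//= expr0 mulr1 big1 ?addr0// => i _.
  by rewrite expr0n mulr0.
suff : pseries_diffs a k = 0.
  by move/eqP; rewrite mulf_eq0 pnatr_eq0/= => /eqP.
apply: ih => t; have := @pseries_sum_diffs _ _ h t.
suff -> : limn (pseries (pseries_diffs a) t) = 0 by [].
have [_ <-] := is_derive_pseries_sum t h.
by rewrite derive_val.
Unshelve. all: by end_near. Qed.

(** The Taylor coefficients H_k(x)/k! of the generating function: in this
    normalization the entries of L are constant along diagonals. *)
Definition hermite_coef (H : nat -> {poly R}) k x : R := (H k).[x] / k`!%:R.

Section Gen.
Variables (H : nat -> {poly R}) (hH : is_hermite H).
Let h := hermite_coef H.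

Lemma hermite_coef_gen x : pseries_sum (h ^~ x) (fun t => expR (2 * x * t - t ^+ 2)).
Proof.
move=> t; rewrite (_ : pseries _ t = series (fun k => t ^+ k / k`!%:R * (H k).[x])).
  exact: hH.
apply/funext => n; apply: eq_bigr => k _; rewrite /h /hermite_coef /=.
by rewrite mulrAC [RHS]mulrAC [t ^+ k * _]mulrC.
Qed.

Lemma hermite_coef0 x : h 0 x = 1.
Proof.
have := @hermite_coef_gen x 0; rewrite mulr0 expr0n subr0 expR0.
move/cvg_lim => /(_ (@norm_hausdorff _ _)) <-.
apply/esym/lim_near_cst; first exact: norm_hausdorff.
near=> n; rewrite /pseries/= /series/=.
rewrite -[n]prednK; last by near: n; exists 1%N.
rewrite big_nat_recl//= expr0 mulr1 big1 ?addr0// => i _.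
by rewrite expr0n mulr0.
Unshelve. all: by end_near. Qed.

(** The generating function F satisfies F' = (2x - 2t) F; compare coefficients. *)
Lemma hermite_coef_rec k x :
  k.+1%:R * h k.+1 x = 2 * x * h k x - 2 * (if k is j.+1 then h j x else 0).
Proof.
pose s k := if k is j.+1 then h j x else 0.
apply/eqP; rewrite -subr_eq0; apply/eqP.
apply: (@pseries_sum0 (fun k => pseries_diffs (h ^~ x) k
    - (2 * x * h k x - 2 * s k))) => t.
pose F t := expR (2 * x * t - t ^+ 2).
have hF : limn (pseries (pseries_diffs (h ^~ x)) t) = (2 * x - 2 * t) * F t.
  have [_ <-] := is_derive_pseries_sum t (@hermite_coef_gen x).
  have h2 : is_derive t 1 (fun t => 2 * x * t - t ^+ 2) (2 * x - 2 * t).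
    by apply: is_derive_eq; rewrite /GRing.scale/=; ring.
  have [_ ->] := is_derive1_comp (is_derive_expR _) h2.
  by rewrite mulrC.
have c1 : pseries (pseries_diffs (h ^~ x)) t @ \oo --> (2 * x - 2 * t) * F t.
  by rewrite -hF; exact: (pseries_sum_diffs (@hermite_coef_gen x)).
have c2 : pseries (h ^~ x) t @ \oo --> F t by exact: hermite_coef_gen.
have c3 : pseries s t @ \oo --> t * F t.
  rewrite -cvg_shiftS.
  have -> : [sequence pseries s t n.+1]_n = fun n => t * pseries (h ^~ x) t n.
    apply/funext => n; rewrite /pseries /series/= big_nat_recl//= mul0r add0r.
    by rewrite mulr_sumr; apply: eq_bigr => i _; rewrite exprS; ring.
  exact: cvgMr.
have -> : 0 = (2 * x - 2 * t) * F t - (2 * x * F t - 2 * (t * F t)) by ring.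
rewrite [X in X @ _ --> _](_ : _ = fun n => pseries (pseries_diffs (h ^~ x)) t n
   - (2 * x * pseries (h ^~ x) t n - 2 * pseries s t n)).
  by apply: cvgB => //; apply: cvgB; apply: cvgMr.
apply/funext => n; rewrite /pseries /series/= !mulr_sumr -!sumrB.
by apply: eq_bigr => i _; ring.
Qed.

(** From the three-term recurrence alone, by induction on two consecutive
    indices. *)
Lemma is_derive_hermite_coef k x :
  is_derive x 1 (h k) (2 * if k is j.+1 then h j x else 0).
Proof.
have h0 : h 0 = cst 1 by apply/funext => y; exact: hermite_coef0.
suff : is_derive x 1 (h k) (2 * if k is j.+1 then h j x else 0) /\
       is_derive x 1 (h k.+1) (2 * h k x) by case.
elim: k => [|k [ih1 ih2]].
  rewrite h0 mulr0; split; first exact: is_derive_cst.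
  have -> : h 1 = fun y => 2 * y.
    apply/funext => y; have := hermite_coef_rec 0 y.
    by rewrite mul1r hermite_coef0 mulr0 subr0 mulr1.
  by apply: is_derive_eq; rewrite /GRing.scale/=; ring.
split => //.
have -> : h k.+2 = fun y => k.+2%:R^-1 * (2 * (y * h k.+1 y) + (- 2) * h k y).
  by apply/funext => y; have := hermite_coef_rec k.+1 y => hr; apply: (mulfI (x := k.+2%:R));
   rewrite ?pnatr_eq0// hr mulVKf ?pnatr_eq0//; ring.
have := is_deriveMf (is_derive_cstf (k.+2%:R^-1) x)
  (is_deriveDf (is_deriveMf (is_derive_cstf 2 x) (is_deriveMf (is_derive_idf x) ih2))
     (is_deriveMf (is_derive_cstf (-2) x) ih1)).
move=> /is_derive_eq; apply.
have := hermite_coef_rec k x => hr.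
rewrite !mul0r !add0r mul1r.
apply: (mulfI (x := k.+2%:R)); rewrite ?pnatr_eq0// mulVKf ?pnatr_eq0//.
have -> : k.+2%:R * (2 * h k.+1 x) = 2 * (k.+1%:R * h k.+1 x + h k.+1 x).
  by rewrite -[k.+2%:R]natr1; ring.
rewrite hr; ring.
Qed.

End Gen.
End Hermite.

(** * Complex-valued functions *)

Section Cplx.
Context {R : realType}.
Notation C := R[i].
Notation mu := (@lebesgue_measure R).
Notation gauss := (@gauss_fun R).
Notation Re := complex.Re.
Notation Im := complex.Im.
Implicit Types (f g u v : R -> C) (x c : R) (z w : C).

Lemma cReD z w : Re (z + w) = Re z + Re w. Proof. by case: z; case: w. Qed.
Lemma cImD z w : Im (z + w) = Im z + Im w. Proof. by case: z; case: w. Qed.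
Lemma cReN z : Re (- z) = - Re z. Proof. by case: z. Qed.
Lemma cImN z : Im (- z) = - Im z. Proof. by case: z. Qed.
Lemma cReM z w : Re (z * w) = Re z * Re w - Im z * Im w.
Proof. by case: z; case: w. Qed.
Lemma cImM z w : Im (z * w) = Re z * Im w + Im z * Re w.
Proof. by case: z; case: w. Qed.
Lemma cRe_conj z : Re (Num.conj z) = Re z. Proof. by case: z. Qed.
Lemma cIm_conj z : Im (Num.conj z) = - Im z. Proof. by case: z. Qed.
Lemma ReIm_eq z w : Re z = Re w -> Im z = Im w -> z = w.
Proof. by case: z w => [a b] [c d] /= -> ->. Qed.
Lemma cReC c : Re c%:C = c. Proof. by []. Qed.
Lemma cImC c : Im c%:C = 0. Proof. by []. Qed.
Lemma cRe_sum I (r : seq I) (F : I -> C) : Re (\sum_(i <- r) F i) = \sum_(i <- r) Re (F i).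
Proof. by elim/big_rec2: _ => // i y1 y2 _ <-; rewrite cReD. Qed.
Definition is_cderive f (f' : R -> C) := forall x,
  is_derive x 1 (fun y => Re (f y)) (Re (f' x)) /\
  is_derive x 1 (fun y => Im (f y)) (Im (f' x)).

Definition ccont f := continuous (fun x => Re (f x)) /\ continuous (fun x => Im (f x)).

Lemma ccont_is_cderive f (f' : R -> C) : is_cderive f f' -> ccont f.
Proof.
by move=> h; split;
  [apply: (@continuous_is_derive _ _ (fun x => Re (f' x)))
  |apply: (@continuous_is_derive _ _ (fun x => Im (f' x)))] => x; have [] := h x.
Qed.

Lemma is_cderive_cst z : is_cderive (fun=> z) (fun=> 0).
Proof. by move=> x; split; exact: is_derive_cstf. Qed.

Lemma is_cderiveD f g (f' g' : R -> C) : is_cderive f f' -> is_cderive g g' ->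
  is_cderive (fun x => f x + g x) (fun x => f' x + g' x).
Proof.
move=> hf hg x; have [f1 f2] := hf x; have [g1 g2] := hg x; split.
  under eq_fun do rewrite cReD.
  by rewrite cReD; exact: is_deriveDf.
under eq_fun do rewrite cImD.
by rewrite cImD; exact: is_deriveDf.
Qed.

Lemma is_cderiveM f g (f' g' : R -> C) : is_cderive f f' -> is_cderive g g' ->
  is_cderive (fun x => f x * g x) (fun x => f' x * g x + f x * g' x).
Proof.
move=> hf hg x; have [f1 f2] := hf x; have [g1 g2] := hg x; split.
  under eq_fun do rewrite cReM.
  have := is_deriveDf (is_deriveMf f1 g1) (is_deriveNf (is_deriveMf f2 g2)).
  by move=> /is_derive_eq; apply; rewrite cReD !cReM; ring.
under eq_fun do rewrite cImM.
have := is_deriveDf (is_deriveMf f1 g2) (is_deriveMf f2 g1).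
by move=> /is_derive_eq; apply; rewrite cImD !cImM; ring.
Qed.

Lemma is_cderive_sum I (r : seq I) (F F' : I -> R -> C) :
  (forall i, is_cderive (F i) (F' i)) ->
  is_cderive (fun x => \sum_(i <- r) F i x) (fun x => \sum_(i <- r) F' i x).
Proof.
move=> h; elim: r => [|i r ih].
  rewrite (_ : (fun x => _) = fun=> 0); last by apply/funext => x; rewrite big_nil.
  rewrite (_ : (fun x => \sum_(i <- _) F' i x) = fun=> 0); last by apply/funext => x; rewrite big_nil.
  exact: is_cderive_cst.
rewrite (_ : (fun x => _) = fun x => F i x + \sum_(j <- r) F j x); last first.
  by apply/funext => x; rewrite big_cons.
rewrite (_ : (fun x => \sum_(i <- _) F' i x) = fun x => F' i x + \sum_(j <- r) F' j x); last first.
  by apply/funext => x; rewrite big_cons.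
exact: is_cderiveD.
Qed.

Definition cintegrable f := integrableR (fun x => Re (f x)) /\ integrableR (fun x => Im (f x)).
Definition cintegral f : C := (\int[mu]_x Re (f x)) +i* (\int[mu]_x Im (f x)).

Lemma eq_cintegral f g : f =1 g -> cintegral f = cintegral g.
Proof. by move=> /funext ->. Qed.

Lemma cintegrable0 : cintegrable (fun=> 0).
Proof. by split; exact: (@integrable0 _ _ _ mu setT). Qed.

Lemma cintegral0 : cintegral (fun=> 0) = 0.
Proof. by apply: ReIm_eq; rewrite /= /Rintegral integral0. Qed.

Lemma cintegrableD f g : cintegrable f -> cintegrable g -> cintegrable (fun x => f x + g x).
Proof.
move=> [f1 f2] [g1 g2]; split.
  by under eq_fun do rewrite cReD; exact: integrableRD.
by under eq_fun do rewrite cImD; exact: integrableRD.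
Qed.

Lemma cintegralD f g : cintegrable f -> cintegrable g ->
  cintegral (fun x => f x + g x) = cintegral f + cintegral g.
Proof.
move=> [f1 f2] [g1 g2]; apply: ReIm_eq => /=.
  by under eq_Rintegral do rewrite cReD; rewrite RintegralD.
by under eq_Rintegral do rewrite cImD; rewrite RintegralD.
Qed.

Lemma cintegrableZ z f : cintegrable f -> cintegrable (fun x => z * f x).
Proof.
move=> [f1 f2]; split.
  have := integrableRD (integrableRZ (Re z) f1) (integrableRZ (- Im z) f2).
  by congr (integrableR _); apply/funext => x; rewrite cReM mulNr.
have := integrableRD (integrableRZ (Re z) f2) (integrableRZ (Im z) f1).
by congr (integrableR _); apply/funext => x; rewrite cImM.
Qed.

Lemma cintegralZ z f : cintegrable f -> cintegral (fun x => z * f x) = z * cintegral f.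
Proof.
move=> [f1 f2].
have i1 := integrableRZ (Re z) f1; have i2 := integrableRZ (Im z) f2.
have i3 := integrableRZ (Re z) f2; have i4 := integrableRZ (Im z) f1.
apply: ReIm_eq; rewrite ?cReM ?cImM /=.
  under eq_Rintegral do rewrite cReM.
  by rewrite RintegralB// !RintegralZl.
under eq_Rintegral do rewrite cImM.
by rewrite RintegralD// !RintegralZl.
Qed.

Lemma cintegrable_sum I (r : seq I) (F : I -> R -> C) :
  (forall i, cintegrable (F i)) -> cintegrable (fun x => \sum_(i <- r) F i x).
Proof.
move=> h; elim: r => [|i r ih].
  by under eq_fun do rewrite big_nil; exact: cintegrable0.
by under eq_fun do rewrite big_cons; exact: cintegrableD.
Qed.

Lemma cintegral_sum I (r : seq I) (F : I -> R -> C) : (forall i, cintegrable (F i)) ->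
  cintegral (fun x => \sum_(i <- r) F i x) = \sum_(i <- r) cintegral (F i).
Proof.
move=> h; elim: r => [|i r ih].
  by under eq_fun do rewrite big_nil; rewrite big_nil cintegral0.
under eq_fun do rewrite big_cons.
by rewrite cintegralD ?ih ?big_cons//; exact: cintegrable_sum.
Qed.

Definition gauss_cL2 f := gaussL2 (fun x => Re (f x)) /\ gaussL2 (fun x => Im (f x)).

Definition gauss_pairing f g x : C := (gauss x)%:C * (f x * Num.conj (g x)).

Lemma Re_gauss_pairing f g x : Re (gauss_pairing f g x) =
  gauss x * (Re (f x) * Re (g x)) + gauss x * (Im (f x) * Im (g x)).
Proof. by rewrite !cReM cRe_conj cIm_conj cReC cImC; ring. Qed.

Lemma Im_gauss_pairing f g x : Im (gauss_pairing f g x) =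
  gauss x * (Im (f x) * Re (g x)) - gauss x * (Re (f x) * Im (g x)).
Proof. by rewrite !cImM cReM cRe_conj cIm_conj cReC cImC; ring. Qed.

Lemma cintegrable_gauss_pairing f g : gauss_cL2 f -> gauss_cL2 g -> cintegrable (gauss_pairing f g).
Proof.
move=> [f1 f2] [g1 g2]; split.
  by under eq_fun do rewrite Re_gauss_pairing; apply: integrableRD; exact: gaussL2_mul.
under eq_fun do rewrite Im_gauss_pairing.
have := integrableRD (gaussL2_mul f2 g1) (integrableRZ (-1) (gaussL2_mul f1 g2)).
by congr (integrableR _); apply/funext => x; rewrite mulN1r.
Qed.

Definition chermite_op c u (u1 u2 : R -> C) x : C :=
  u2 x - (2 * x)%:C * u1 x - c%:C * u x.

Lemma Re_chermite_op c u (u1 u2 : R -> C) x : Re (chermite_op c u u1 u2 x) =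
  hermite_op c (fun x => Re (u x)) (fun x => Re (u1 x)) (fun x => Re (u2 x)) x.
Proof. by rewrite /chermite_op /hermite_op !(cReD, cReN, cReM, cReC, cImC) !mul0r !subr0. Qed.

Lemma Im_chermite_op c u (u1 u2 : R -> C) x : Im (chermite_op c u u1 u2 x) =
  hermite_op c (fun x => Im (u x)) (fun x => Im (u1 x)) (fun x => Im (u2 x)) x.
Proof. by rewrite /chermite_op /hermite_op !(cImD, cImN, cImM, cReC, cImC) !mul0r !addr0. Qed.

(** The real and imaginary parts of the pairing are combinations of the four
    real pairings of the parts of u and v, and the operator has real
    coefficients. *)
Lemma chermite_op_symmetric c u (u1 u2 : R -> C) v (v1 v2 : R -> C) : 0 <= c ->
  is_cderive u u1 -> is_cderive u1 u2 -> ccont u2 ->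
  is_cderive v v1 -> is_cderive v1 v2 -> ccont v2 ->
  gauss_cL2 u -> gauss_cL2 (chermite_op c u u1 u2) -> gauss_cL2 v -> gauss_cL2 (chermite_op c v v1 v2) ->
  cintegral (gauss_pairing (chermite_op c u u1 u2) v) = cintegral (gauss_pairing u (chermite_op c v v1 v2)).
Proof.
move=> c0 hu hu1 [cu2 cu2'] hv hv1 [cv2 cv2'] [Lu Lu'] [LLu LLu'] [Lv Lv'] [LLv LLv'].
rewrite (_ : (fun x => Re (chermite_op c u u1 u2 x)) =
  hermite_op c (fun x => Re (u x)) (fun x => Re (u1 x)) (fun x => Re (u2 x))) in LLu;
  last by apply/funext => x; rewrite Re_chermite_op.
rewrite (_ : (fun x => Im (chermite_op c u u1 u2 x)) =
  hermite_op c (fun x => Im (u x)) (fun x => Im (u1 x)) (fun x => Im (u2 x))) in LLu';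
  last by apply/funext => x; rewrite Im_chermite_op.
rewrite (_ : (fun x => Re (chermite_op c v v1 v2 x)) =
  hermite_op c (fun x => Re (v x)) (fun x => Re (v1 x)) (fun x => Re (v2 x))) in LLv;
  last by apply/funext => x; rewrite Re_chermite_op.
rewrite (_ : (fun x => Im (chermite_op c v v1 v2 x)) =
  hermite_op c (fun x => Im (v x)) (fun x => Im (v1 x)) (fun x => Im (v2 x))) in LLv';
  last by apply/funext => x; rewrite Im_chermite_op.
have dR f f' : is_cderive f f' -> forall x, is_derive x 1 (fun y => Re (f y)) (Re (f' x)).
  by move=> h x; have [] := h x.
have dI f f' : is_cderive f f' -> forall x, is_derive x 1 (fun y => Im (f y)) (Im (f' x)).
  by move=> h x; have [] := h x.
have gRR := hermite_op_symmetric c0 (dR _ _ hu) (dR _ _ hu1) (dR _ _ hv) (dR _ _ hv1) cu2 cv2 Lu LLu Lv LLv.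
have gII := hermite_op_symmetric c0 (dI _ _ hu) (dI _ _ hu1) (dI _ _ hv) (dI _ _ hv1) cu2' cv2' Lu' LLu' Lv' LLv'.
have gRI := hermite_op_symmetric c0 (dR _ _ hu) (dR _ _ hu1) (dI _ _ hv) (dI _ _ hv1) cu2 cv2' Lu LLu Lv' LLv'.
have gIR := hermite_op_symmetric c0 (dI _ _ hu) (dI _ _ hu1) (dR _ _ hv) (dR _ _ hv1) cu2' cv2 Lu' LLu' Lv LLv.
apply: ReIm_eq => /=.
  under eq_Rintegral do rewrite Re_gauss_pairing Re_chermite_op Im_chermite_op.
  under [RHS]eq_Rintegral do rewrite Re_gauss_pairing Re_chermite_op Im_chermite_op.
  by rewrite !RintegralD ?gRR ?gII//; exact: gaussL2_mul.
under eq_Rintegral do rewrite Im_gauss_pairing Re_chermite_op Im_chermite_op.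
under [RHS]eq_Rintegral do rewrite Im_gauss_pairing Re_chermite_op Im_chermite_op.
by rewrite !RintegralB ?gRI ?gIR//; exact: gaussL2_mul.
Qed.

End Cplx.

(** * Matrix-valued functions and the factor L *)

Section MxDeriv.
Context {R : realType}.
Notation C := R[i].
Notation Re := complex.Re.
Notation Im := complex.Im.

Definition is_mxderive m n (F F' : R -> 'M[C]_(m, n)) :=
  forall i j, is_cderive (fun x => F x i j) (fun x => F' x i j).

Lemma is_mxderive_cst m n (M : 'M[C]_(m, n)) : is_mxderive (fun=> M) (fun=> 0).
Proof.
move=> i j; rewrite (_ : (fun x : R => (0 : 'M[C]_(m, n)) i j) = fun=> 0).
  exact: is_cderive_cst.
by apply/funext => x; rewrite mxE.
Qed.

Lemma is_mxderiveD m n (F F' G G' : R -> 'M[C]_(m, n)) :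
  is_mxderive F F' -> is_mxderive G G' ->
  is_mxderive (fun x => F x + G x) (fun x => F' x + G' x).
Proof.
move=> hF hG i j; have := is_cderiveD (hF i j) (hG i j).
by congr is_cderive; apply/funext => x; rewrite mxE.
Qed.

Lemma is_mxderiveM m n p (F F' : R -> 'M[C]_(m, n)) (G G' : R -> 'M[C]_(n, p)) :
  is_mxderive F F' -> is_mxderive G G' ->
  is_mxderive (fun x => F x *m G x) (fun x => F' x *m G x + F x *m G' x).
Proof.
move=> hF hG i j.
have := is_cderive_sum (index_enum _) (fun k => is_cderiveM (hF i k) (hG k j)).
congr is_cderive; apply/funext => x; first by rewrite mxE.
by rewrite !mxE -big_split.
Qed.

Lemma eq_is_mxderive m n (F F' G' : R -> 'M[C]_(m, n)) :
  is_mxderive F F' -> (forall x, F' x = G' x) -> is_mxderive F G'.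
Proof. by move=> h /funext <-. Qed.

Lemma mx_derivE m (F F' : R -> 'M[C]_m) : is_mxderive F F' -> mx_deriv F = F'.
Proof.
move=> h; apply/funext => x; apply/matrixP => i j; rewrite mxE.
by have [[_ h1] [_ h2]] := h i j x; apply: ReIm_eq; rewrite /= derive1E.
Qed.

Lemma mx_C2_deriv m (F : R -> 'M[C]_m) : mx_C2 F ->
  [/\ is_mxderive F (mx_deriv F), is_mxderive (mx_deriv F) (mx_deriv (mx_deriv F))
    & forall i j, ccont (fun x => mx_deriv (mx_deriv F) x i j)].
Proof.
have reE (G : R -> 'M[C]_m) i j : (fun y => Re (mx_deriv G y i j)) = derive1 (mx_re G i j).
  by apply/funext => y; rewrite mxE.
have imE (G : R -> 'M[C]_m) i j : (fun y => Im (mx_deriv G y i j)) = derive1 (mx_im G i j).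
  by apply/funext => y; rewrite mxE.
have dE (f : R -> R) x : derivable f x 1 -> is_derive x 1 f (derive1 f x).
  by move=> d; rewrite derive1E; exact: derivableP.
have rr (G : R -> 'M[C]_m) i j : mx_re (mx_deriv G) i j = derive1 (mx_re G i j) by rewrite -reE.
have ii (G : R -> 'M[C]_m) i j : mx_im (mx_deriv G) i j = derive1 (mx_im G i j) by rewrite -imE.
move=> h; split=> i j; have [[d1 d2 d3] [e1 e2 e3]] := h i j.
- by move=> x; rewrite !mxE; split; apply: dE.
- move=> x; rewrite reE imE [X in Re X]mxE [X in Im X]mxE /= rr ii.
  by split; apply: dE.
- rewrite !derive1nS in d3 e3; split; [rewrite reE rr; exact: d3|rewrite imE ii; exact: e3].
Qed.

Lemma eq_continuousf (f g : R -> R) : f =1 g -> continuous f -> continuous g.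
Proof. by move=> /funext ->. Qed.

Lemma ccontM (f g : R -> C) : ccont f -> ccont g -> ccont (fun x => f x * g x).
Proof.
move=> [f1 f2] [g1 g2]; split.
  by apply: (@eq_continuousf (fun x => Re (f x) * Re (g x) - Im (f x) * Im (g x))) => [x|]; [rewrite cReM|continuity].
by apply: (@eq_continuousf (fun x => Re (f x) * Im (g x) + Im (f x) * Re (g x))) => [x|]; [rewrite cImM|continuity].
Qed.

Lemma ccontD (f g : R -> C) : ccont f -> ccont g -> ccont (fun x => f x + g x).
Proof.
move=> [f1 f2] [g1 g2]; split.
  by apply: (@eq_continuousf (fun x => Re (f x) + Re (g x))) => [x|]; [rewrite cReD|continuity].
by apply: (@eq_continuousf (fun x => Im (f x) + Im (g x))) => [x|]; [rewrite cImD|continuity].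
Qed.

Lemma ccont_sum I (r : seq I) (F : I -> R -> C) : (forall i, ccont (F i)) ->
  ccont (fun x => \sum_(i <- r) F i x).
Proof.
move=> h; elim: r => [|i r ih].
  by under eq_fun do rewrite big_nil; split => x; exact: cvg_cst.
by under eq_fun do rewrite big_cons; exact: ccontD.
Qed.

Definition mxcont m n (F : R -> 'M[C]_(m, n)) := forall i j, ccont (fun x => F x i j).

Lemma mxcont_deriv m n (F F' : R -> 'M[C]_(m, n)) : is_mxderive F F' -> mxcont F.
Proof. by move=> h i j; exact: ccont_is_cderive (h i j). Qed.

Lemma mxcontM m n p (F : R -> 'M[C]_(m, n)) (G : R -> 'M[C]_(n, p)) :
  mxcont F -> mxcont G -> mxcont (fun x => F x *m G x).
Proof.
move=> hF hG i j.
have := ccont_sum (index_enum _) (fun k => ccontM (hF i k) (hG k j)).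
by congr ccont; apply/funext => x; rewrite mxE.
Qed.

Lemma mxcontD m n (F G : R -> 'M[C]_(m, n)) :
  mxcont F -> mxcont G -> mxcont (fun x => F x + G x).
Proof.
move=> hF hG i j; have := ccontD (hF i j) (hG i j).
by congr ccont; apply/funext => x; rewrite mxE.
Qed.
End MxDeriv.

Section Factor.
Context {R : realType} {N : nat}.
Notation C := R[i].
Variables (H : nat -> {poly R}) (hH : is_hermite H).
Notation h := (hermite_coef H).
Implicit Types (x : R) (i j : 'I_N.+1).

(** A shifts rows down by one and doubles them. *)
Lemma AmxM p (M : 'M[C]_(N.+1, p)) i (j : 'I_p) : (@Amx R N *m M) i j =
  if unlift ord0 i is Some k then 2 * M (widen_ord (leqnSn N) k) j else 0.
Proof.
rewrite /Amx -scalemxAl mxE mulmx_suml summxE.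
have dE (k : 'I_N) : (delta_mx (lift ord0 k) (widen_ord (leqnSn N) k) *m M) i j =
   (i == lift ord0 k)%:R * M (widen_ord (leqnSn N) k) j.
  rewrite mxE (bigD1 (widen_ord (leqnSn N) k))//= big1 ?addr0 => [|l lk].
    by rewrite mxE eqxx andbT.
  by rewrite mxE (negPf lk) andbF mul0r.
under eq_bigr do rewrite dE.
case: unliftP => [k|] ->.
  rewrite (bigD1 k)//= big1 ?addr0 ?eqxx ?mul1r// => l lk.
  by rewrite (inj_eq lift_inj) eq_sym (negPf lk) mul0r.
by rewrite big1 ?mulr0// => k _; rewrite mul0r.
Qed.

Lemma natmul_complex n (r : R) : (n%:R * r)%:C = n%:R * r%:C :> C.
Proof. by rewrite rmorphM rmorph_nat. Qed.

Lemma LmxE x i j : Lmx H x i j = if (j <= i)%N then (h (i - j) x)%:C else 0.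
Proof. by rewrite mxE. Qed.

Lemma AmxLmx x i j :
  (Amx *m Lmx H x) i j = if (j < i)%N then (2 * h (i - j).-1 x)%:C else 0.
Proof.
rewrite AmxM; case: unliftP => [k|] ->; last by rewrite /=.
rewrite LmxE lift0 /= ltnS; case: ifP => jk; last by rewrite mulr0.
by rewrite subSn//= natmul_complex.
Qed.

Lemma AmxAmxLmx x i j :
  (Amx *m (Amx *m Lmx H x)) i j =
  if (j.+1 < i)%N then (4 * h (i - j).-2 x)%:C else 0.
Proof.
rewrite AmxM; case: unliftP => [k|] ->; last by rewrite /=.
rewrite AmxLmx lift0 /= ltnS; case: ifP => jk; last by rewrite mulr0.
rewrite subSn 1?ltnW//= -natmul_complex mulrA; congr (_%:C); ring.
Qed.

(** Entrywise this is h_k' = 2 h_(k-1). *)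
Lemma is_mxderive_Lmx : is_mxderive (Lmx H) (fun x => @Amx R N *m Lmx H x).
Proof.
move=> i j x; rewrite AmxLmx.
under eq_fun do rewrite LmxE.
under [X in _ /\ is_derive _ _ X _]eq_fun do rewrite LmxE.
have hd := is_derive_hermite_coef hH (i - j) x.
case: (ltngtP j i) => ij /=; last 2 first.
- by split; exact: is_derive_cstf.
- rewrite ij subnn in hd *; split; last exact: is_derive_cstf.
  by rewrite mulr0 in hd.
split; last exact: is_derive_cstf.
move: hd; have : (0 < i - j)%N by rewrite subn_gt0.
by case: (i - j)%N.
Qed.

(** L = exp(xA - A^2/4) and J A - A J = A, so moving J past L differentiates the
    exponent; entrywise this is the three-term recurrence of the Hermite
    polynomials. It cancels the coupling that conjugation by L produces. *)
Lemma JmxLmx x : Jmx *m Lmx H x = Lmx H x *m Jmx + x%:C *: (@Amx R N *m Lmx H x)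
   - 2^-1 *: (Amx *m (Amx *m Lmx H x)).
Proof.
apply/matrixP => i j.
rewrite /Jmx /real_diag mul_diag_mx mul_mx_diag.
rewrite [LHS]mxE [RHS]mxE [X in X + _]mxE [X in X + _ + _]mxE.
rewrite [X in _ + X + _]mxE [X in _ + _ + X]mxE [X in _ + _ - X]mxE.
rewrite AmxLmx AmxAmxLmx !mxE -/(h _ _).
case: (ltngtP j i) => ij; last 2 first.
- have -> : (j.+1 < i)%N = false by lia.
  by rewrite !(mul0r, mulr0) addr0 subr0.
- have -> : (j.+1 < i)%N = false by lia.
  rewrite ij !mulr0 addr0 subr0 mulrC.
  by [].
have -> : (j.+1 < i)%N = (0 < (i - j).-1)%N by lia.
have iE : (i.+1%:R : R) = j.+1%:R + (i - j)%:R by rewrite -natrD addSn subnKC// ltnW.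
rewrite iE; have : (0 < i - j)%N by rewrite subn_gt0.
have hr := hermite_coef_rec hH (i - j).-1 x.
case: (i - j)%N hr => // k /= hr _.
have half : (2^-1 : C) = (2^-1 : R)%:C by rewrite fmorphV rmorph_nat.
have aux (a b h0 h1 h2 : R) : b * h2 = 2 * x * h1 - 2 * h0 ->
    (a + b)%:C * h2%:C = h2%:C * a%:C + x%:C * (2 * h1)%:C - 2^-1 * (4 * h0)%:C :> C.
  move=> e; have e2 : (a + b) * h2 = a * h2 + (2 * x * h1 - 2 * h0) by rewrite -e; ring.
  rewrite half; apply: ReIm_eq;
    rewrite !(cReD, cReN, cReM, cImD, cImN, cImM, cReC, cImC) ?e2; by field.
case: ifP => k0; first by apply: aux; case: k k0 hr.
rewrite (aux _ _ 0 (h k x)) ?mulr0//.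
by case: k k0 hr => //= _; rewrite mulr0.
Qed.
End Factor.

(** * Conjugation by L and symmetry of the matrix operator *)

Section Alpha.
Context {R : realType} {N : nat}.
Notation C := R[i].
Notation gauss := (@gauss_fun R).
Variables (H : nat -> {poly R}) (hH : is_hermite H) (alpha : 'I_N.+1 -> R).
Hypothesis alpha_neq0 : forall k, alpha k != 0.
Notation S := (@real_diag R N alpha).
Notation L := (@Lalpha R N H alpha).
Notation A := (@Aalpha R N alpha).
Notation J := (@Jmx R N).
Implicit Types (x : R) (i j : 'I_N.+1) (G K : R -> 'M[C]_N.+1).

Lemma real_diag_unit : S \in unitmx.
Proof.
rewrite unitmxE det_diag unitfE; apply/prodf_neq0 => i _.
by rewrite mxE; apply: contra_neq (alpha_neq0 i) => /complexI.
Qed.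

Lemma Lmx_unit x : @Lmx R N H x \in unitmx.
Proof.
rewrite unitmxE det_trig; last first.
  by apply/is_trig_mxP => i j ij; rewrite LmxE leqNgt ij.
rewrite big1 ?unitr1// => i _.
by rewrite LmxE leqnn subnn hermite_coef0.
Qed.

Lemma Lalpha_unit x : L x \in unitmx.
Proof. by rewrite !unitmx_mul unitmx_inv real_diag_unit Lmx_unit. Qed.

Lemma AalphaLalpha x : A *m L x = S *m (Amx *m Lmx H x) *m invmx S.
Proof. by rewrite /Aalpha /Lalpha !mulmxA mulmxKV ?real_diag_unit. Qed.

Lemma is_mxderive_Lalpha : is_mxderive L (fun x => A *m L x).
Proof.
have h := is_mxderiveM (is_mxderiveM (is_mxderive_cst S) (@is_mxderive_Lmx _ N _ hH))
  (is_mxderive_cst (invmx S)).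
apply: eq_is_mxderive h _ => x.
by rewrite mulmx0 addr0 mul0mx add0r AalphaLalpha.
Qed.

Lemma real_diagC (d e : 'I_N.+1 -> R) :
  real_diag d *m real_diag e = real_diag e *m real_diag d :> 'M[C]_N.+1.
Proof.
by apply/matrixP => i j; rewrite mul_diag_mx mul_mx_diag !mxE; case: eqVneq => [->|_];
  rewrite ?mulr1n ?mulr0n ?mulr0 ?mul0r// mulrC.
Qed.

Lemma JLalpha x : J *m L x = L x *m J + x%:C *: (A *m L x)
  - 2^-1 *: (A *m (A *m L x)).
Proof.
have SJ : S *m J = J *m S by exact: real_diagC.
(* Diagonal matrices commute, so J also commutes with the inverse of S. *)
have VJ : invmx S *m J = J *m invmx S.
  rewrite -[RHS](mulKmx real_diag_unit) [S *m _]mulmxA SJ -[J *m S *m _]mulmxA.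
  by rewrite mulmxV ?real_diag_unit// mulmx1.
have -> : A *m (A *m L x) = S *m (Amx *m (Amx *m Lmx H x)) *m invmx S.
  by rewrite AalphaLalpha /Aalpha !mulmxA mulmxKV ?real_diag_unit.
have := @JmxLmx R N H hH x; rewrite AalphaLalpha /Lalpha; move: SJ VJ.
move: J S (invmx S) (Lmx H x) (Amx *m Lmx H x) (Amx *m (Amx *m Lmx H x)).
move=> J0 S0 V L0 AL AAL SJ VJ JL.
rewrite -[S0 *m L0 *m V *m J0]mulmxA VJ !mulmxA -SJ -[S0 *m J0 *m _]mulmxA JL.
by rewrite mulmxBr mulmxDr mulmxBl mulmxDl -!scalemxAr -!scalemxAl !mulmxA.
Qed.

(** The function G L, and the expressions of its first two derivatives in terms
    of those of G, obtained from L' = A L. *)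
Definition twist0 G x := G x *m L x.
Definition twist1 G x := mx_deriv G x *m L x + G x *m (A *m L x).
Definition twist2 G x :=
  (mx_deriv (mx_deriv G) x *m L x + mx_deriv G x *m (A *m L x)) +
  (mx_deriv G x *m (A *m L x) + G x *m (A *m (A *m L x))).

(** Conjugation by L turns D into Q'' - 2x Q' - 2 Q J: the first-order term 2A
    is absorbed by L' = A L and the conjugate of J by the identity JLalpha. *)
Lemma D_hermite_twist G x : D_hermite alpha G x *m L x =
  twist2 G x - (2 * x)%:C *: twist1 G x - twist0 G x *m (2 *: J).
Proof.
rewrite /D_hermite /right_diffop /twist0 /twist1 /twist2.
have := JLalpha x; move: (L x) (A) J => L0 A0 J0 JL.
move: (G x) (mx_deriv G x) (mx_deriv (mx_deriv G) x) => G0 G1 G2.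
rewrite mulmx1 mulmxDr !mulmxDl !mulmxN !mulNmx mul_mx_scalar.
rewrite -!scalemxAr -!scalemxAl -!mulmxA JL mulmxBr mulmxDr -!scalemxAr.
move: (G2 *m L0) (G1 *m L0) (G1 *m (A0 *m L0)) (G0 *m (A0 *m L0))
  (G0 *m (A0 *m (A0 *m L0))) (G0 *m (L0 *m J0)) => a b c d e f.
have e2 : (2 * x)%:C = 2 * x%:C :> C by rewrite natmul_complex.
apply/matrixP => i j; by rewrite !mxE e2; field.
Qed.

(** As J is diagonal, the entries of G L decouple: the j-th column sees the
    scalar operator with constant 2(j + 1). *)
Lemma D_hermite_twistE G i j x : (D_hermite alpha G x *m L x) i j =
  chermite_op (2 * j.+1%:R) (fun x => twist0 G x i j) (fun x => twist1 G x i j)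
    (fun x => twist2 G x i j) x.
Proof.
have entryB (a : C) (P Q Z : 'M[C]_N.+1) :
  (P - a *: Q - Z) i j = P i j - a * Q i j - Z i j by rewrite !mxE.
have entryJ (P : 'M[C]_N.+1) : (P *m (2 *: J)) i j = (2 * j.+1%:R)%:C * P i j.
  by rewrite -scalemxAr mxE mul_mx_diag mxE mxE natmul_complex [P i j * _]mulrC mulrA.
by rewrite D_hermite_twist entryB entryJ.
Qed.

Lemma is_mxderive_twist0 G : mx_C2 G -> is_mxderive (twist0 G) (twist1 G).
Proof.
by move=> /mx_C2_deriv[d1 d2 _]; exact: is_mxderiveM d1 is_mxderive_Lalpha.
Qed.

Lemma is_mxderive_ALalpha : is_mxderive (fun x => A *m L x) (fun x => A *m (A *m L x)).
Proof.
have h := is_mxderiveM (is_mxderive_cst A) is_mxderive_Lalpha.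
by apply: eq_is_mxderive h _ => x; rewrite mul0mx add0r.
Qed.

Lemma is_mxderive_twist1 G : mx_C2 G -> is_mxderive (twist1 G) (twist2 G).
Proof.
move=> /mx_C2_deriv[d1 d2 _].
exact: is_mxderiveD (is_mxderiveM d2 is_mxderive_Lalpha)
  (is_mxderiveM d1 is_mxderive_ALalpha).
Qed.

Lemma mxcont_twist2 G : mx_C2 G -> mxcont (twist2 G).
Proof.
move=> /mx_C2_deriv[d1 d2 d3].
have cL := mxcont_deriv is_mxderive_Lalpha.
have cAL := mxcont_deriv is_mxderive_ALalpha.
have cAAL : mxcont (fun x => A *m (A *m L x)).
  by apply: mxcontM cAL; exact: mxcont_deriv (is_mxderive_cst A).
have c0 := mxcont_deriv d1; have c1 := mxcont_deriv d2.
apply: mxcontD; apply: mxcontD; exact: mxcontM.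
Qed.

Section Sym.
Variables (delta : 'I_N.+1 -> R) (delta_gt0 : forall k, 0 < delta k).
Notation W := (Walpha H alpha delta).

(** The weight is e^{-x^2} L Delta L^*, so pairing G and K is pairing the rows
    of G L and K L in a weighted sum of scalar Gaussian pairings. *)
Lemma W_entry G K x i k : (G x *m W x *m (K x)^t*) i k =
  \sum_j (delta j)%:C * gauss_pairing (fun x => (G x *m L x) i j) (fun x => (K x *m L x) k j) x.
Proof.
rewrite /Walpha -scalemxAr -scalemxAl mxE.
have -> : G x *m (L x *m real_diag delta *m (L x)^t*) *m (K x)^t* =
   ((G x *m L x) *m real_diag delta) *m (K x *m L x)^t*.
  by move: (L x) => L0; rewrite trmx_mul map_mxM !mulmxA.
rewrite mxE mulr_sumr; apply: eq_bigr => j _.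
have entryD (P : 'M[C]_N.+1) : (P *m real_diag delta) i j = P i j * (delta j)%:C.
  by rewrite /real_diag mul_mx_diag mxE mxE.
have entryT (P : 'M[C]_N.+1) : (P ^t*) j k = Num.conj (P k j) by rewrite !mxE.
rewrite entryD entryT /gauss_pairing /gauss_fun; ring.
Qed.

(** A diagonal entry of G W G^* is a sum of nonnegative terms delta_j |u_ij|^2,
    so each of them is dominated by the sum. *)
Lemma sq_integrable_gauss_cL2 G i j : mxcont G -> sq_integrable W G ->
  gauss_cL2 (fun x => (G x *m L x) i j).
Proof.
move=> cG sG.
have [c1 c2] := mxcontM cG (mxcont_deriv is_mxderive_Lalpha) i j.
have [s1 _] := sG i i.
have key (f : R -> R) : continuous f ->
    (forall x, f x ^+ 2 <= complex.Re ((G x *m L x) i j) ^+ 2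
                           + complex.Im ((G x *m L x) i j) ^+ 2) -> gaussL2 f.
  move=> cf hf; split=> //.
  have := integrableRZ (delta j)^-1 s1; apply: integrableR_le => [|x]; first by continuity.
  rewrite normrM !ger0_norm ?gauss_fun_ge0 ?sqr_ge0//.
  rewrite ler_pdivlMl ?delta_gt0// /mx_re W_entry cRe_sum (bigD1 j)//=.
  have wE l : complex.Re ((delta l)%:C * gauss_pairing (fun x => (G x *m L x) i l)
      (fun x => (G x *m L x) i l) x) = delta l * (gauss x *
      (complex.Re ((G x *m L x) i l) ^+ 2 + complex.Im ((G x *m L x) i l) ^+ 2)).
    by rewrite cReM Re_gauss_pairing cReC cImC; ring.
  rewrite wE -[leLHS]addr0; apply: lerD.
    by rewrite ler_wpM2l ?(ltW (delta_gt0 _))// ler_wpM2l ?gauss_fun_ge0.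
  apply: sumr_ge0 => l _; rewrite wE.
  by rewrite !mulr_ge0 ?(ltW (delta_gt0 _)) ?gauss_fun_ge0// addr_ge0 ?sqr_ge0.
by split; apply: key => // x; rewrite ?lerDl ?lerDr sqr_ge0.
Qed.

Lemma mx_integralE (F : R -> 'M[C]_N.+1) i k : mx_integral F i k = cintegral (fun x => F x i k).
Proof. by rewrite mxE. Qed.

Lemma mxcont_D_hermite G : mx_C2 G -> mxcont (D_hermite alpha G).
Proof.
move=> /mx_C2_deriv[d1 d2 d3].
have c0 := mxcont_deriv d1; have c1 := mxcont_deriv d2.
have cc (M : 'M[C]_N.+1) : mxcont (fun=> M) := mxcont_deriv (is_mxderive_cst M).
apply: mxcontD; first apply: mxcontD.
- exact: mxcontM.
- apply: mxcontM => //; apply: mxcontD => // i j.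
  have E x : (- (2 * x%:C)%:M : 'M[C]_N.+1) i j = (- (2 * x * (i == j)%:R))%:C.
    rewrite !mxE; case: (i == j); last by rewrite mulr0n mulr0 !oppr0.
    rewrite mulr1n mulr1 -natmul_complex.
    by rewrite rmorphN.
  split.
    apply: (@eq_continuousf _ (fun x => - (2 * x * (i == j)%:R))) => [x|]; last by continuity.
    by rewrite E.
  apply: (@eq_continuousf _ (fun=> 0)) => [x|]; last by continuity.
  by rewrite E.
- exact: mxcontM.
Qed.

(** After conjugation, the claim is a finite sum of scalar ones. *)
Lemma D_hermite_symmetric : symmetric_wrt W (D_hermite alpha).
Proof.
move=> G K CG CK sG sDG sK sDK.
have [/mxcont_deriv cG _ _] := mx_C2_deriv CG.
have [/mxcont_deriv cK _ _] := mx_C2_deriv CK.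
apply/matrixP => i k; rewrite [LHS]mx_integralE [RHS]mx_integralE.
under eq_cintegral do rewrite W_entry.
under [RHS]eq_cintegral do rewrite W_entry.
have LG l j := @sq_integrable_gauss_cL2 G l j cG sG.
have LK l j := @sq_integrable_gauss_cL2 K l j cK sK.
have LDG l j := @sq_integrable_gauss_cL2 _ l j (mxcont_D_hermite CG) sDG.
have LDK l j := @sq_integrable_gauss_cL2 _ l j (mxcont_D_hermite CK) sDK.
rewrite !cintegral_sum; try by move=> j; apply: cintegrableZ; exact: cintegrable_gauss_pairing.
apply: eq_bigr => j _; rewrite !cintegralZ; try exact: cintegrable_gauss_pairing.
apply: (f_equal (fun z => (delta j)%:C * z)).
have EG l : (fun x => (D_hermite alpha G x *m L x) l j) =
  chermite_op (2 * j.+1%:R) (fun x => twist0 G x l j) (fun x => twist1 G x l j)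
    (fun x => twist2 G x l j) by apply/funext => x; exact: D_hermite_twistE.
have EK l : (fun x => (D_hermite alpha K x *m L x) l j) =
  chermite_op (2 * j.+1%:R) (fun x => twist0 K x l j) (fun x => twist1 K x l j)
    (fun x => twist2 K x l j) by apply/funext => x; exact: D_hermite_twistE.
have := LDG i j; have := LDK k j; rewrite EG EK => LDKj LDGj.
exact: (chermite_op_symmetric _ (is_mxderive_twist0 CG i j) (is_mxderive_twist1 CG i j)
  (mxcont_twist2 CG i j) (is_mxderive_twist0 CK k j) (is_mxderive_twist1 CK k j)
  (mxcont_twist2 CK k j) (LG i j) LDGj (LK k j) LDKj).
Qed.

End Sym.
End Alpha.

(** * Gaussian moments and polynomial functions *)

Section Moments.
Context {R : realType}.
Notation C := R[i].
Notation mu := (@lebesgue_measure R).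
Notation gauss := (@gauss_fun R).
Implicit Types (x : R) (n : nat).

Lemma integrable_expR_half : integrableR (fun x : R => expR (- x ^+ 2 / 2)).
Proof.
have := integrableRZ (normal_peak 1)^-1 (@integrable_normal_pdf R 0 1).
congr (integrableR _); apply/funext => x.
have p0 : normal_peak (1 : R) != 0 by rewrite gt_eqF// normal_peak_gt0.
rewrite normal_pdfE// mulKf// /normal_fun subr0; congr expR.
by rewrite expr1n mulr2n.
Qed.

(** One half of the exponent is spent on the power: (x^2/2)^m / m! <= e^{x^2/2}. *)
Lemma integrable_gauss_exp n : integrableR (fun x => gauss x * x ^+ n).
Proof.
have cg k : continuous (fun x : R => gauss x * x ^+ k) by continuity.
case: n => [|n].
  by have := @integrableT_gauss R; congr (integrableR _); apply/funext => x; rewrite mulr1.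
pose c : R := 2 ^+ n.+1 * n.+1`!%:R.
apply: (@integrableR_le _ _ (fun x => gauss x + c * expR (- x ^+ 2 / 2))) => // [x|].
  rewrite normrM ger0_norm ?gauss_fun_ge0//.
  have gE : gauss x = expR (- x ^+ 2 / 2) * expR (- x ^+ 2 / 2).
    by rewrite /gauss_fun -expRD; congr expR; field.
  (* |y| <= 1 + y^2 replaces the power by an even one. *)
  apply: (@le_trans _ _ (gauss x * (1 + (x ^+ 2) ^+ n.+1))).
    rewrite ler_wpM2l ?gauss_fun_ge0// exprAC -(real_normK (num_real (x ^+ n.+1))).
    have := sqr_ge0 (`|x ^+ n.+1| - 1); have := normr_ge0 (x ^+ n.+1); lra.
  rewrite mulrDr mulr1 lerD2l gE -mulrA [leRHS]mulrC ler_wpM2l ?expR_ge0//.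
  rewrite mulrC -ler_pdivlMr ?expR_gt0// mulNr expRN invrK.
  have := @expR_ge1Dxn R (x ^+ 2 / 2) n; rewrite divr_ge0 ?sqr_ge0// => /(_ isT) h.
  have h2 : (x ^+ 2 / 2) ^+ n.+1 / n.+1`!%:R <= expR (x ^+ 2 / 2) by lra.
  rewrite (_ : (x ^+ 2) ^+ n.+1 = c * ((x ^+ 2 / 2) ^+ n.+1 / n.+1`!%:R)).
    by rewrite ler_wpM2l// mulr_ge0// exprn_ge0.
  have f0 : n.+1`!%:R != 0 :> R by rewrite pnatr_eq0 -lt0n fact_gt0.
  have t0 : (2 : R) ^+ n.+1 != 0 by rewrite expf_neq0.
  by rewrite /c expr_div_n; field; rewrite f0.
apply: integrableRD; first exact: integrableT_gauss.
exact: integrableRZ integrable_expR_half.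
Qed.

Lemma integrableR_sum I (r : seq I) (F : I -> R -> R) :
  (forall i, integrableR (F i)) -> integrableR (fun x => \sum_(i <- r) F i x).
Proof.
move=> h; elim: r => [|i r ih].
  by under eq_fun do rewrite big_nil; exact: integrable0.
by under eq_fun do rewrite big_cons; exact: integrableRD.
Qed.

Lemma integrable_gauss_poly (p : {poly R}) : integrableR (fun x => gauss x * p.[x]).
Proof.
have := integrableR_sum (index_enum 'I_(size p)) (fun i => integrableRZ p`_i (integrable_gauss_exp i)).
congr (integrableR _); apply/funext => x; rewrite horner_coef mulr_sumr.
by apply: eq_bigr => i _; rewrite mulrCA.
Qed.

Lemma gaussL2_poly (p : {poly R}) : gaussL2 (horner p).
Proof.
split; first exact: continuous_horner.
have := integrable_gauss_poly (p ^+ 2).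
by congr (integrableR _); apply/funext => x; rewrite horner_exp.
Qed.

Lemma centered_itv_length x (d : R) : 0 < d ->
  fine (mu [set` `[x - d / 2, x + d / 2]%R]) = d.
Proof.
move=> d0; rewrite lebesgue_measure_itv/= lte_fin.
have -> : x - d / 2 < x + d / 2 by lra.
rewrite -EFinB/=; lra.
Qed.

(** Otherwise the function exceeds half of a positive value on an interval of
    positive length. *)
Lemma continuous_integral_eq0 (f : R -> R) : continuous f -> (forall x, 0 <= f x) -> integrableR f ->
  \int[mu]_x f x = 0 -> forall x, f x = 0.
Proof.
move=> cf f0 If intf0 x; apply/eqP; apply/negPn/negP => fx.
have {}fx : 0 < f x by rewrite lt_neqAle eq_sym fx f0.
have /= [d d0 hd] : \forall y \near x, f x / 2 < f y.
  by apply: (cvgr_gt _ (cf x)); rewrite ltr_pdivrMr// ltr_pMr// ltr1n.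
pose I : set R := [set` `[x - d / 2, x + d / 2]%R].
have mI : measurable I by exact: measurable_itv.
have If' : mu.-integrable I (EFin \o f) by exact: integrableS If.
have I1 : \int[mu]_(y in I) (f x / 2) <= \int[mu]_(y in I) f y.
  apply: le_Rintegral => //.
    by apply: continuous_compact_integrable; [exact: segment_compact|apply: continuous_subspaceT; continuity].
  move=> y; rewrite /I/= in_itv/= => /andP[y1 y2]; apply/ltW/hd => /=.
  rewrite ltr_norml; have d0' : 0 < d by []. apply/andP; split; lra.
have I2 : \int[mu]_(y in I) f y <= \int[mu]_y f y.
  rewrite Rintegral_mkcond; apply: le_Rintegral => //.
    by rewrite -restrict_EFin; apply/(integrable_mkcond _ _).1.
  by move=> y _; rewrite patchE; case: ifP.
have : 0 < \int[mu]_(y in I) (f x / 2).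
  rewrite Rintegral_cst// centered_itv_length//.
  by rewrite mulr_gt0 ?divr_gt0.
by rewrite ltNge (le_trans I1)// -intf0.
Qed.

(** Being a polynomial as a function of the real variable: the form in which
    integrability is used, stable under the matrix operations. *)
Definition cpolyfun (f : R -> C) := exists p : {poly C}, forall x, f x = p.[x%:C].

Lemma cpolyfunD f g : cpolyfun f -> cpolyfun g -> cpolyfun (fun x => f x + g x).
Proof. by move=> [p pE] [q qE]; exists (p + q) => x; rewrite hornerD pE qE. Qed.
Lemma cpolyfunM f g : cpolyfun f -> cpolyfun g -> cpolyfun (fun x => f x * g x).
Proof. by move=> [p pE] [q qE]; exists (p * q) => x; rewrite hornerM pE qE. Qed.
Lemma cpolyfun_cst z : cpolyfun (fun=> z).
Proof. by exists z%:P => x; rewrite hornerC. Qed.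
Lemma cpolyfun_id : cpolyfun (fun x => x%:C).
Proof. by exists 'X => x; rewrite hornerX. Qed.
Lemma cpolyfun_sum I (r : seq I) (F : I -> R -> C) :
  (forall i, cpolyfun (F i)) -> cpolyfun (fun x => \sum_(i <- r) F i x).
Proof.
move=> h; elim: r => [|i r ih].
  by under eq_fun do rewrite big_nil; exact: cpolyfun_cst.
by under eq_fun do rewrite big_cons; exact: cpolyfunD.
Qed.
Lemma cpolyfun_real (p : {poly R}) : cpolyfun (fun x => (p.[x])%:C).
Proof. by exists (map_poly (real_complex R) p) => x; rewrite horner_map. Qed.

Lemma cpolyfun_ReIm f : cpolyfun f -> exists p q : {poly R},
  (forall x, complex.Re (f x) = p.[x]) /\ (forall x, complex.Im (f x) = q.[x]).
Proof.
move=> [p pE]; suff [a [b [ha hb]]] : exists a b : {poly R},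
    (forall x, complex.Re p.[x%:C] = a.[x]) /\ (forall x, complex.Im p.[x%:C] = b.[x]).
  by exists a, b; split => x; rewrite pE.
elim/poly_ind: p {pE} => [|p c [a [b [ha hb]]]].
  by exists 0, 0; split => x; rewrite !horner0.
exists (a * 'X + (complex.Re c)%:P), (b * 'X + (complex.Im c)%:P).
split => x; rewrite !hornerMXaddC ?cReD ?cImD ?cReM ?cImM ?cReC ?cImC.
  by rewrite mulr0 subr0 ha.
by rewrite mulr0 add0r hb.
Qed.

Lemma gauss_cL2_polyfun f : cpolyfun f -> gauss_cL2 f.
Proof.
move=> /cpolyfun_ReIm [p [q [pE qE]]]; split.
  by rewrite (_ : (fun x => _) = horner p); [exact: gaussL2_poly|apply/funext].
by rewrite (_ : (fun x => _) = horner q); [exact: gaussL2_poly|apply/funext].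
Qed.
End Moments.

(** * Matrix polynomials and definiteness of the pairing *)

Section MatrixPoly.
Context {R : realType} {N : nat}.
Notation C := R[i].
Notation gauss := (@gauss_fun R).
Implicit Types (x : R) (i j k : 'I_N.+1) (p q : {poly 'M[C]_N.+1}) (M : 'M[C]_N.+1)
  (F G K : R -> 'M[C]_N.+1).

Definition mxpolyfun F := forall i j, cpolyfun (fun x => F x i j).

Lemma mx_poly_fun_polyfun p : mxpolyfun (mx_poly_fun p).
Proof.
rewrite /mx_poly_fun; elim/poly_ind: p => [|p M ih] i j.
  under eq_fun do rewrite horner0 mxE; exact: cpolyfun_cst.
have := cpolyfunD (cpolyfunM (ih i j) cpolyfun_id) (cpolyfun_cst (M i j)).
congr cpolyfun; apply/funext => x.
by rewrite hornerMXaddC mxE -[_ * _%:M]/(_ *m _%:M) mul_mx_scalar mxE mulrC.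
Qed.

Lemma is_mxderive_poly p : is_mxderive (mx_poly_fun p) (mx_poly_fun p^`()).
Proof.
have xE : is_mxderive (fun x => (x%:C)%:M : 'M[C]_N.+1) (fun=> 1%:M).
  move=> i j x; rewrite !mxE; split.
    have := is_deriveMf (is_derive_idf x) (is_derive_cstf ((i == j)%:R) x).
    rewrite mulr0 addr0 mul1r => h.
    rewrite (_ : (fun y => _) = fun y => y * (i == j)%:R); last first.
      by apply/funext => y; rewrite !mxE; case: (i == j); rewrite ?mulr1n ?mulr0n ?mulr1 ?mulr0.
    by rewrite (_ : complex.Re _ = (i == j)%:R); [|case: (i == j)].
  rewrite (_ : (fun y => _) = fun=> 0); last first.
    by apply/funext => y; rewrite !mxE; case: (i == j).
  rewrite (_ : complex.Im _ = 0); last by case: (i == j).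
  exact: is_derive_cstf.
rewrite /mx_poly_fun; elim/poly_ind: p => [|p M ih].
  rewrite deriv0 (_ : (fun x => _) = fun=> 0); last by apply/funext => x; rewrite horner0.
  exact: is_mxderive_cst.
have h := is_mxderiveD (is_mxderiveM ih xE) (is_mxderive_cst M).
rewrite (_ : (fun x => (p * 'X + M%:P).[_]) = fun x => p.[(x%:C)%:M] *m (x%:C)%:M + M); last first.
  by apply/funext => x; rewrite hornerMXaddC.
apply: eq_is_mxderive h _ => x.
by rewrite derivMXaddC hornerD hornerMX mulmx1 addr0 addrC.
Qed.

Lemma mx_C2_derive F (F1 F2 : R -> 'M[C]_N.+1) :
  is_mxderive F F1 -> is_mxderive F1 F2 -> mxcont F2 -> mx_C2 F.
Proof.
move=> h1 h2 c i j.
have d1 (f f' : R -> R) : (forall x, is_derive x 1 f (f' x)) -> derive1 f = f'.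
  by move=> h; apply/funext => x; rewrite derive1E; have [_ ->] := h x.
have key (f f1 f2 : R -> R) : (forall x, is_derive x 1 f (f1 x)) ->
    (forall x, is_derive x 1 f1 (f2 x)) -> continuous f2 -> C2fun f.
  move=> hf hf1 cf2; split.
  - by move=> x; have [] := hf x.
  - by move=> x; rewrite (d1 _ _ hf); have [] := hf1 x.
  - by rewrite derive1nS derive1n1 (d1 _ _ hf) (d1 _ _ hf1); exact: cf2.
have [c1 c2] := c i j.
split.
  by apply: (key _ (fun x => complex.Re (F1 x i j)) (fun x => complex.Re (F2 x i j)) _ _ c1) => x; [have [] := h1 i j x|have [] := h2 i j x].
by apply: (key _ (fun x => complex.Im (F1 x i j)) (fun x => complex.Im (F2 x i j)) _ _ c2) => x; [have [] := h1 i j x|have [] := h2 i j x].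
Qed.

Lemma mx_C2_poly p : mx_C2 (mx_poly_fun p).
Proof.
exact: mx_C2_derive (is_mxderive_poly p) (is_mxderive_poly _)
  (mxcont_deriv (is_mxderive_poly _)).
Qed.

Lemma mxpolyfunM F G : mxpolyfun F -> mxpolyfun G -> mxpolyfun (fun x => F x *m G x).
Proof.
move=> hF hG i j.
have := cpolyfun_sum (index_enum _) (fun k => cpolyfunM (hF i k) (hG k j)).
by congr cpolyfun; apply/funext => x; rewrite mxE.
Qed.

Lemma mxpolyfun_cst M : mxpolyfun (fun=> M).
Proof. by move=> i j; exact: cpolyfun_cst. Qed.

Lemma comm_poly_scalar q x : comm_poly q ((x%:C)%:M : 'M[C]_N.+1).
Proof. by rewrite /comm_poly -[LHS]/(_ *m _) -[RHS]/(_ *m _) scalar_mxC. Qed.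

Lemma mx_poly_funM p q x : mx_poly_fun (p * q) x = mx_poly_fun p x *m mx_poly_fun q x.
Proof. by rewrite /mx_poly_fun hornerM_comm//; exact: comm_poly_scalar. Qed.

Lemma mx_poly_funC M x : mx_poly_fun M%:P x = M.
Proof. exact: hornerC. Qed.

Definition mxintegrable F := forall i k, cintegrable (fun x => F x i k).

Lemma mx_integralD F G : mxintegrable F -> mxintegrable G ->
  mx_integral (fun x => F x + G x) = mx_integral F + mx_integral G.
Proof.
move=> hF hG; apply/matrixP => i k; rewrite [LHS]mx_integralE [RHS]mxE.
rewrite (mx_integralE F) (mx_integralE G) -cintegralD//.
by apply: eq_cintegral => x; rewrite mxE.
Qed.

Lemma mx_integralMl M F : mxintegrable F ->
  mx_integral (fun x => M *m F x) = M *m mx_integral F.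
Proof.
move=> hF; apply/matrixP => i k; rewrite [LHS]mx_integralE [RHS]mxE.
under eq_cintegral do rewrite mxE.
rewrite cintegral_sum => [|j]; last exact: cintegrableZ.
by apply: eq_bigr => j _; rewrite cintegralZ// (mx_integralE F).
Qed.

Lemma mx_integralMr M F : mxintegrable F ->
  mx_integral (fun x => F x *m M) = mx_integral F *m M.
Proof.
move=> hF; apply/matrixP => i k; rewrite [LHS]mx_integralE [RHS]mxE.
under eq_cintegral do (rewrite mxE; under eq_bigr do rewrite mulrC).
rewrite cintegral_sum => [|j]; last exact: cintegrableZ.
by apply: eq_bigr => j _; rewrite cintegralZ// (mx_integralE F) mulrC.
Qed.

Variables (H : nat -> {poly R}) (hH : is_hermite H) (alpha delta : 'I_N.+1 -> R).
Hypothesis alpha_neq0 : forall k, alpha k != 0.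
Hypothesis delta_gt0 : forall k, 0 < delta k.
Notation W := (Walpha H alpha delta).
Notation L := (Lalpha H alpha).
Notation A := (@Aalpha R N alpha).

Lemma mxpolyfun_Lalpha : mxpolyfun L.
Proof.
apply: mxpolyfunM; last exact: mxpolyfun_cst.
apply: mxpolyfunM; first exact: mxpolyfun_cst.
move=> i j; under eq_fun do rewrite LmxE.
case: (j <= i)%N; last exact: cpolyfun_cst.
have := cpolyfunM (cpolyfun_real (H (i - j))) (cpolyfun_cst ((i - j)`!%:R^-1)%:C).
by congr cpolyfun; apply/funext => x; rewrite -rmorphM.
Qed.

Lemma mxintegrable_polyW F G : mxpolyfun F -> mxpolyfun G ->
  mxintegrable (fun x => F x *m W x *m (G x)^t*).
Proof.
move=> pF pG i k.
under eq_fun do rewrite W_entry.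
apply: cintegrable_sum => j; apply: cintegrableZ; apply: cintegrable_gauss_pairing;
  by apply: gauss_cL2_polyfun; apply: mxpolyfunM => //; exact: mxpolyfun_Lalpha.
Qed.

Lemma sq_integrable_poly F : mxpolyfun F -> sq_integrable W F.
Proof. by move=> pF i j; exact: (mxintegrable_polyW pF pF i j). Qed.

(** Vanishing of a diagonal entry of the integral forces each |u_ij|^2 to vanish,
    where u = F L; then F = 0 because L is invertible. *)
Lemma W_definite F : mxpolyfun F ->
  mx_integral (fun x => F x *m W x *m (F x)^t*) = 0 -> forall x, F x = 0.
Proof.
move=> pF F0 x.
suff FL : F x *m L x = 0.
  by rewrite -[F x](mulmxK (Lalpha_unit hH alpha_neq0 x)) FL mul0mx.
have pFL := mxpolyfunM pF mxpolyfun_Lalpha.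
apply/matrixP => i j; rewrite [RHS]mxE.
pose f k y := complex.Re (gauss_pairing (fun y => (F y *m L y) i k) (fun y => (F y *m L y) i k) y).
have fE k y : f k y = gauss y * (complex.Re ((F y *m L y) i k) ^+ 2 +
    complex.Im ((F y *m L y) i k) ^+ 2).
  by rewrite /f Re_gauss_pairing; ring.
have cf k : continuous (f k).
  have [[c1 _] [c2 _]] := gauss_cL2_polyfun (pFL i k).
  by apply: (eq_continuousf (fun y => esym (fE k y))); continuity.
have f0 k y : 0 <= f k y by rewrite fE mulr_ge0 ?gauss_fun_ge0// addr_ge0 ?sqr_ge0.
have If k : integrableR (f k) by have [] := cintegrable_gauss_pairing (gauss_cL2_polyfun (pFL i k)) (gauss_cL2_polyfun (pFL i k)).
have : (mx_integral (fun x => F x *m W x *m (F x)^t*)) i i = 0 by rewrite F0 mxE.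
rewrite mx_integralE; under eq_cintegral do rewrite W_entry.
have cw k := cintegrable_gauss_pairing (gauss_cL2_polyfun (pFL i k)) (gauss_cL2_polyfun (pFL i k)).
rewrite cintegral_sum; last by move=> k; apply: cintegrableZ; exact: cw.
move/(congr1 (@complex.Re R)); rewrite cRe_sum.
under eq_bigr do rewrite cintegralZ// cReM cReC cImC mul0r subr0.
move=> S0.
have ge0 k : 0 <= delta k * \int[lebesgue_measure]_y f k y.
  by rewrite mulr_ge0 ?(ltW (delta_gt0 _))// Rintegral_ge0.
have := S0; move/eqP; rewrite psumr_eq0 => [/allP/(_ j)|k _]; last exact: ge0.
rewrite mem_index_enum => /(_ isT)/=; rewrite mulf_eq0 gt_eqF//= => /eqP fj0.
have := continuous_integral_eq0 (cf j) (f0 j) (If j) fj0 x.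
rewrite fE => /eqP; rewrite mulf_eq0 gt_eqF ?expR_gt0//= paddr_eq0 ?sqr_ge0//.
rewrite !sqrf_eq0 => /andP[/eqP h1 /eqP h2].
exact: ReIm_eq.
Qed.

Lemma mx_poly_funD p q x : mx_poly_fun (p + q) x = mx_poly_fun p x + mx_poly_fun q x.
Proof. exact: hornerD. Qed.

Lemma mx_poly_funN p x : mx_poly_fun (- p) x = - mx_poly_fun p x.
Proof. exact: hornerN. Qed.

Lemma mx_poly_funX x : mx_poly_fun ('X : {poly 'M[C]_N.+1}) x = (x%:C)%:M.
Proof. exact: hornerX. Qed.

(** The action of D on polynomials, written with formal derivatives so that
    degrees can be read off coefficients. *)
Definition D_hermite_poly p : {poly 'M[C]_N.+1} :=
  p^`()^`() + p^`() * (- ('X *+ 2) + (2 *: A)%:P) - p * (2 *: Jmx)%:P.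

Lemma D_hermite_polyE p : D_hermite alpha (mx_poly_fun p) = mx_poly_fun (D_hermite_poly p).
Proof.
apply/funext => x.
rewrite /D_hermite /right_diffop !(mx_derivE (is_mxderive_poly _)) /D_hermite_poly mulr2n.
rewrite !(mx_poly_funD, mx_poly_funN, mx_poly_funM, mx_poly_funC, mx_poly_funX).
have -> : (2 * x%:C)%:M = (x%:C)%:M + (x%:C)%:M :> 'M[C]_N.+1.
  by rewrite -raddfD mulr_natl mulr2n.
by rewrite mulmx1 mulmxN.
Qed.

Lemma size_D_hermite_poly p : (size (D_hermite_poly p) <= size p)%N.
Proof.
apply/leq_sizeP => j pj.
rewrite /D_hermite_poly mulrDr mulrN mulrnAr !(coefD, coefN, coefMn, coefMC, coefMX, coef_deriv).
rewrite !(@nth_default _ 0 p) ?(leq_trans pj)//; try by lia.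
by rewrite !mul0rn !mul0r if_same !addr0 oppr0 !addr0.
Qed.

(** * Orthogonal polynomials as eigenfunctions *)

Section Orth.
Variables (P : nat -> {poly 'M[C]_N.+1}) (hP : is_monic_MVOP W P).
Notation "<< p , q >>" := (mx_integral (fun x => mx_poly_fun p x *m W x *m (mx_poly_fun q x)^t*)).

Let pintegrable p q : mxintegrable (fun x => mx_poly_fun p x *m W x *m (mx_poly_fun q x)^t*).
Proof. by apply: mxintegrable_polyW; exact: mx_poly_fun_polyfun. Qed.

Lemma formDl p1 p2 q : << p1 + p2, q >> = << p1, q >> + << p2, q >>.
Proof.
rewrite -[RHS]mx_integralD//; congr mx_integral; apply/funext => x.
by rewrite {1}/mx_poly_fun hornerD !mulmxDl.
Qed.

Lemma formDr p q1 q2 : << p, q1 + q2 >> = << p, q1 >> + << p, q2 >>.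
Proof.
rewrite -[RHS]mx_integralD//; congr mx_integral; apply/funext => x.
by rewrite {2}/mx_poly_fun hornerD linearD map_mxD mulmxDr.
Qed.

Lemma formMl M p q : << M%:P * p, q >> = M *m << p, q >>.
Proof.
rewrite -[RHS]mx_integralMl//; congr mx_integral; apply/funext => x.
by rewrite mx_poly_funM mx_poly_funC !mulmxA.
Qed.

Lemma formMr M p q : << p, M%:P * q >> = << p, q >> *m M^t*.
Proof.
have <- := @mx_integralMr (M^t*) _ (pintegrable p q).
congr mx_integral; apply/funext => x.
rewrite mx_poly_funM mx_poly_funC.
move: (mx_poly_fun p x) (mx_poly_fun q x) (W x) => p0 q0 W0.
by rewrite trmx_mul map_mxM !mulmxA.
Qed.

Lemma form0r p : << p, 0 >> = 0.
Proof.
have := formMr 0 p 0; rewrite mulr0 => ->.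
by rewrite trmx0 map_mx0 mulmx0.
Qed.

(** The monic P m, m < n, allow subtracting the leading term of q, whatever
    matrix its leading coefficient is. *)
Lemma orthogonal_lower n q : (size q <= n)%N -> << P n, q >> = 0.
Proof.
have [szP monP orthP] := hP.
move: q; suff key m : forall q, (m <= n)%N -> (size q <= m)%N -> << P n, q >> = 0.
  by move=> q qn; exact: key qn.
elim: m => [|m ih] q mn qm.
  by move: qm; rewrite leqn0 size_poly_eq0 => /eqP ->; exact: form0r.
rewrite -[q](subrK ((q`_m)%:P * P m)) formDr formMr orthP; last by move=> nm; lia.
rewrite mul0mx addr0; apply: ih; first exact: ltnW.
apply/leq_sizeP => j; rewrite leq_eqVlt => /orP[/eqP <-|mj].
  have := monP m; rewrite monicE lead_coefE szP /= => /eqP e.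
  by rewrite coefB coefCM e mulr1 subrr.
rewrite coefB coefCM !(@nth_default _ _ _ j) ?mulr0 ?subr0// ?szP//.
exact: leq_trans qm mj.
Qed.

(** The leading terms cancel: at degree n only -2x Q' and -2 Q J contribute, and
    they give -2n - 2J. *)
Lemma size_residual n : (size (D_hermite_poly (P n) - (Gamma n)%:P * P n)%R <= n)%N.
Proof.
have [szP monP _] := hP.
apply/leq_sizeP => j; rewrite leq_eqVlt => /orP[/eqP <-|nj]; last first.
  by rewrite coefB coefCM !nth_default ?mulr0 ?subr0 ?(leq_trans (size_D_hermite_poly _)) ?szP.
have pn : (P n)`_n = 1.
  by have := monP n; rewrite monicE lead_coefE szP /= => /eqP.
rewrite /D_hermite_poly mulrDr mulrN mulrnAr !(coefB, coefD, coefN, coefMn, coefMC, coefMX, coefCM, coef_deriv) pn.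
rewrite (@nth_default _ _ (P n) n.+2) ?szP// (@nth_default _ _ (P n) n.+1) ?szP//.
have -> : (if n == 0%N then 0 else (P n)`_n.-1.+1 *+ n.-1.+1) = 1 *+ n.
  by case: n pn => [|n] //= ->.
have e : (2 * n%:R)%:M = 1 *+ n + 1 *+ n :> 'M[C]_N.+1.
  by rewrite mulr_natl mulr2n raddfD raddfMn.
by rewrite /Gamma e !mul0rn mul0r add0r addr0 mul1r mulr1 subrr.
Qed.

(** The residual r = P_n D - Gamma_n P_n has degree below n, and so has r D. Thus
    <r, r> = <P_n D, r> - Gamma_n <P_n, r> = <P_n, r D> = 0, using symmetry. *)
Lemma MVOP_eigen n x : D_hermite alpha (mx_poly_fun (P n)) x = Gamma n *m mx_poly_fun (P n) x.
Proof.
set r := D_hermite_poly (P n) - (Gamma n)%:P * P n.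
have sr : (size r <= n)%N := size_residual n.
have rr : << r, r >> = 0.
  rewrite {1}/r -mulNr -polyCN formDl formMl orthogonal_lower// mulmx0 addr0.
  have sq p := sq_integrable_poly (mx_poly_fun_polyfun p).
  have sqD p : sq_integrable W (D_hermite alpha (mx_poly_fun p)).
    by rewrite D_hermite_polyE.
  have := D_hermite_symmetric hH alpha_neq0 delta_gt0 (mx_C2_poly (P n)) (mx_C2_poly r)
    (sq _) (sqD _) (sq _) (sqD _).
  rewrite !D_hermite_polyE => ->.
  by apply: orthogonal_lower; exact: leq_trans (size_D_hermite_poly _) sr.
have := W_definite (mx_poly_fun_polyfun r) rr x.
rewrite D_hermite_polyE /r mx_poly_funD mx_poly_funN mx_poly_funM mx_poly_funC.
by move=> /eqP; rewrite subr_eq0 => /eqP.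
Qed.
End Orth.
End MatrixPoly.

Unset Implicit Arguments.

Theorem proposition3p5 (R : realType) (N : nat)
    (H : nat -> {poly R}) (hH : is_hermite H)
    (alpha delta : 'I_N.+1 -> R)
    (alpha_neq0 : forall k, alpha k != 0) (alpha1 : alpha ord0 = 1)
    (delta_gt0 : forall k, 0 < delta k) :
  symmetric_wrt (Walpha H alpha delta) (D_hermite alpha) /\
  (forall P : nat -> {poly 'M[R[i]]_N.+1},
     is_monic_MVOP (Walpha H alpha delta) P ->
     forall (n : nat) (x : R),
       D_hermite alpha (mx_poly_fun (P n)) x
       = Gamma n *m mx_poly_fun (P n) x).
Proof.
split; first exact: D_hermite_symmetric.
by move=> P hP n x; exact: (MVOP_eigen hH alpha_neq0 delta_gt0 hP).
Qed.
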